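(* Let $n>1$ be an integer. Every continuous map $f_0\colon \mathbb{R}\to\mathbb{R}^{2n-1}$ can be approximated in the fine $\mathscr{C}^0$ topology by real analytic injective $\xi_0$-Legendrian immersions $f\colon \mathbb{R}\hookrightarrow \mathbb{R}^{2n-1}$; that is, for every continuous function $\epsilon\colon\mathbb{R}\to(0,+\infty)$ there is a real analytic injective $\xi_0$-Legendrian immersion $f\colon\mathbb{R}\to\mathbb{R}^{2n-1}$ satisfying $|f(t)-f_0(t)|<\epsilon(t)$ for all $t\in\mathbb{R}$.
   Context: The coordinates on $\mathbb{R}^{2n-1}$ are $(x,y,z)$ with $x,y\in\mathbb{R}^{n-1}$ and $z\in\mathbb{R}$. The standard contact structure is $\xi_0=\ker(dz+x\,dy)$, where $x\,dy=\sum_{j=1}^{n-1}x_j\,dy_j$. A smooth curve $f\colon\mathbb{R}\to\mathbb{R}^{2n-1}$ is called $\xi_0$-Legendrian if $\dot f(t)\in(\xi_0)_{f(t)}$ for every $t\in\mathbb{R}$, equivalently $f^*(dz+x\,dy)=0$ (this terminology is used for curves irrespective of the dimension of the manifold). $|\cdot|$ is the Euclidean norm. *)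

(* Defs.v *)
From HB Require Import structures.
From mathcomp Require Import all_boot all_order all_algebra.
From mathcomp Require Import all_classical all_reals all_analysis.

Set Implicit Arguments.
Unset Strict Implicit.
Unset Printing Implicit Defensive.

Import Order.TTheory GRing.Theory Num.Theory.
Import numFieldNormedType.Exports.
Local Open Scope classical_set_scope.
Local Open Scope ring_scope.

(* R^(2n-1) is the space of row vectors (x, y, z) with x and y of length n-1
   and z of length 1; see [contact_dimE]. *)
Definition contact_dim (n : nat) : nat := (n.-1 + n.-1 + 1)%N.

Lemma contact_dimE (n : nat) : (0 < n)%N -> contact_dim n = (2 * n - 1)%N.
Proof. by case: n => // n _; rewrite /contact_dim /= addn1 mul2n doubleS subn1 /= addnn. Qed.

Definition xcoord (R : realType) (n : nat) (p : 'rV[R]_(contact_dim n)) :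
  'rV[R]_n.-1 := lsubmx (lsubmx (p : 'rV[R]_(n.-1 + n.-1 + 1))).

Definition ycoord (R : realType) (n : nat) (p : 'rV[R]_(contact_dim n)) :
  'rV[R]_n.-1 := rsubmx (lsubmx (p : 'rV[R]_(n.-1 + n.-1 + 1))).

Definition zcoord (R : realType) (n : nat) (p : 'rV[R]_(contact_dim n)) : R :=
  rsubmx (p : 'rV[R]_(n.-1 + n.-1 + 1)) 0 0.

(* The 1-form dz + x dy, at the point p, applied to the tangent vector v. *)
Definition contact_form (R : realType) (n : nat)
    (p v : 'rV[R]_(contact_dim n)) : R :=
  zcoord v + \sum_(j < n.-1) xcoord p 0 j * ycoord v 0 j.

Definition contact_structure (R : realType) (n : nat)
    (p : 'rV[R]_(contact_dim n)) : set 'rV[R]_(contact_dim n) :=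
  [set v | contact_form p v = 0].

(* The norm `|v| that the library puts on matrices is the sup norm. *)
Definition euclidean_norm (R : realType) (m : nat) (v : 'rV[R]_m) : R :=
  Num.sqrt (\sum_(i < m) v 0 i ^+ 2).

Definition smooth_curve (R : realType) (m : nat) (f : R -> 'rV[R]_m) : Prop :=
  forall (k : nat) (t : R), derivable (derive1n k f) t 1.

Definition legendrian (R : realType) (n : nat)
    (f : R -> 'rV[R]_(contact_dim n)) : Prop :=
  smooth_curve f /\ forall t : R, contact_structure (f t) (derive1 f t).

Definition immersion (R : realType) (m : nat) (f : R -> 'rV[R]_m) : Prop :=
  smooth_curve f /\ forall t : R, injective ('d f t).

Definition real_analytic (R : realType) (g : R -> R) : Prop :=
  forall t0 : R, exists a : nat -> R,
    \forall t \near t0, pseries a (t - t0) @ \oo --> g t.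

Definition real_analytic_curve (R : realType) (m : nat)
    (f : R -> 'rV[R]_m) : Prop :=
  forall i : 'I_m, real_analytic (fun t => f t 0 i).

(* Main.v *)
Require Import Defs.
From HB Require Import structures.
From mathcomp Require Import all_boot all_order all_algebra.
From mathcomp Require Import all_classical all_reals all_analysis.
From mathcomp Require Import ring lra.

(* The curve is a limit of polynomial Legendrian curves [F_k], where [F_k]
   approximates [f0] on [-k-2, k+2], is an injective immersion on [-k, k], and
   [F_(k+1) - F_k] is tiny in the coefficient norm [sum_i |p_i| (k+1)^i].  This
   norm plays the role of the sup norm on a complex disc: it makes the limit
   entire and controls all derivatives, so the open conditions obtained on
   [-k, k] survive in the limit.

   Extending the approximation from [-s, s] to a larger interval: a Weierstrass
   approximation of [f0], cut off by a polynomial that is close to 1 outside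
   [-s, s] and tiny in coefficient norm, gives a curve that is nearly Legendrian
   near 0 only.  With [G] its contact defect [z' + x y'], one adds
   [- 2 G om cos(N^2 t) / N] to [x] and [N om cos(N^2 t)] to [y'] in one
   coordinate pair: as [N] grows all coordinates move by O(1/N), while the
   average of the product, [- G], removes the defect.

   Injectivity: [x] is perturbed by [la t + 2 mu t (y + nu t)] and [y] by [nu t].
   Each pair of distinct parameters [s < t] rules out a single triple
   [(nu, mu, la)], depending on [(s, t)] in a Lipschitz way, and a Lipschitz
   image of a planar set contains no cube. *)

Set Implicit Arguments.
Unset Strict Implicit.
Unset Printing Implicit Defensive.

Import Order.TTheory GRing.Theory Num.Theory.
Import numFieldNormedType.Exports.
Local Open Scope classical_set_scope.
Local Open Scope ring_scope.

(** * Coefficient norms of polynomials *)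

Section PolyNorm.
Context {R : realType}.
Implicit Types (p q : {poly R}) (r s t : R).

(** Polynomials are chosen because the contact defect of a polynomial curve is a polynomial, and
    subtracting its primitive from [z] makes the curve exactly Legendrian. So it is the primitive of
    the defect, not the defect, that must be small: this is what averaging achieves. Two demands
    conflict: a correction must act outside [-s, s] and yet be tiny in the coefficient norm of some
    radius r < s. Analytic functions cannot be cut off, and the coefficient norm of cos(N^2 t)
    explodes with N. Hence each oscillating factor is multiplied by a step that vanishes on an
    interval slightly larger than [-r, r], and only the product is replaced by a polynomial, with an
    error chosen after N. The frequency N^2 balances the scales: y moves by N / N^2, x by 1 / N, and
    the product of the changes of x and y' stays of order one. Each derivative costs some radius, as
    in Cauchy's estimate, which explains the strict chains of radii. Injectivity is not preserved by
    limits; it survives because it is secured on compact intervals together with a C^1 margin, and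
    all later changes are charged to that margin. *)

Definition pnorm r p : R := \sum_(i < size p) `|p`_i| * r ^+ i.

Lemma pnormE r p n : (size p <= n)%N -> pnorm r p = \sum_(i < n) `|p`_i| * r ^+ i.
Proof.
move=> h; rewrite /pnorm (big_ord_widen n (fun i => `|p`_i| * r ^+ i) h) big_mkcond /=.
by apply: eq_bigr => i _; case: ltnP => // hi; rewrite nth_default// normr0 mul0r.
Qed.

Lemma pnorm_abs r p : pnorm r p = (\poly_(i < size p) `|p`_i|).[r].
Proof. by rewrite horner_poly. Qed.

Lemma pnorm_ge0 r p : 0 <= r -> 0 <= pnorm r p.
Proof. by move=> r0; apply: sumr_ge0 => i _; rewrite mulr_ge0// exprn_ge0. Qed.

Lemma pnorm0 r : pnorm r 0 = 0.
Proof. by rewrite /pnorm size_poly0 big_ord0. Qed.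

Lemma pnormN r p : pnorm r (- p) = pnorm r p.
Proof. by rewrite /pnorm size_polyN; apply: eq_bigr => i _; rewrite coefN normrN. Qed.

Lemma pnormD r p q : 0 <= r -> pnorm r (p + q) <= pnorm r p + pnorm r q.
Proof.
move=> r0; set n := maxn (size p) (size q).
rewrite (@pnormE _ _ n) ?size_polyD// (@pnormE _ p n) ?leq_maxl// (@pnormE _ q n) ?leq_maxr//.
rewrite -big_split /=; apply: ler_sum => i _.
by rewrite -mulrDl coefD ler_wpM2r ?exprn_ge0// ler_normD.
Qed.

Lemma pnormB r p q : 0 <= r -> pnorm r (p - q) <= pnorm r p + pnorm r q.
Proof. by move=> r0; rewrite (le_trans (pnormD _ _ r0))// pnormN. Qed.

Lemma pnorm_distC r p q : pnorm r (p - q) = pnorm r (q - p).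
Proof. by rewrite -opprB pnormN. Qed.

Lemma pnorm_sum r (I : Type) (l : seq I) (P : pred I) (F : I -> {poly R}) : 0 <= r ->
  pnorm r (\sum_(i <- l | P i) F i) <= \sum_(i <- l | P i) pnorm r (F i).
Proof.
move=> r0; elim/big_ind2 : _ => [|p1 x1 p2 x2 h1 h2|//]; first by rewrite pnorm0.
by rewrite (le_trans (pnormD _ _ r0))// lerD.
Qed.

Lemma pnorm_coef_le r p q : 0 <= r -> (forall i, `|p`_i| <= q`_i) -> pnorm r p <= q.[r].
Proof.
move=> r0 h; rewrite (@pnormE _ _ (maxn (size p) (size q))) ?leq_maxl//.
rewrite (horner_coef_wide _ (leq_maxr (size p) (size q))).
by apply: ler_sum => i _; rewrite ler_wpM2r ?exprn_ge0.
Qed.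

(** The coefficients of [p * q] are dominated by those of the product of the two polynomials with
    absolute values as coefficients, and evaluation at [r] is multiplicative. *)
Lemma pnormM r p q : 0 <= r -> pnorm r (p * q) <= pnorm r p * pnorm r q.
Proof.
move=> r0; rewrite [X in _ <= X * _]pnorm_abs [X in _ <= _ * X]pnorm_abs -hornerM.
apply: pnorm_coef_le => // i; rewrite !coefM (le_trans (ler_norm_sum _ _ _))//.
apply: ler_sum => j _; rewrite normrM !coef_poly.
by do 2!case: ltnP => [_|/(nth_default _) ->]; rewrite ?normr0 ?mulr0 ?mul0r.
Qed.

Lemma pnormC r (c : R) : pnorm r c%:P = `|c|.
Proof. by rewrite (@pnormE _ _ 1) ?size_polyC_leq1// big_ord1 coefC eqxx expr0 mulr1. Qed.

Lemma pnormXn r n : 0 <= r -> pnorm r 'X^n = r ^+ n.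
Proof.
move=> r0; rewrite (@pnormE _ _ n.+1) ?size_polyXn// big_ord_recr /= coefXn eqxx normr1 mul1r.
by rewrite big1 ?add0r// => i _; rewrite coefXn (ltn_eqF (ltn_ord i)) normr0 mul0r.
Qed.

Lemma pnormX r : 0 <= r -> pnorm r 'X = r.
Proof. by move=> r0; rewrite -[X in pnorm _ X]expr1 pnormXn. Qed.

Lemma pnormZ r (c : R) p : 0 <= r -> pnorm r (c *: p) <= `|c| * pnorm r p.
Proof. by move=> r0; rewrite -mul_polyC (le_trans (pnormM _ _ r0))// pnormC. Qed.

Lemma pnorm_exp r p n : 0 <= r -> pnorm r (p ^+ n) <= pnorm r p ^+ n.
Proof.
move=> r0; elim: n => [|n ih]; first by rewrite !expr0 -[1]/1%:P pnormC normr1.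
by rewrite !exprS (le_trans (pnormM _ _ r0))// ler_wpM2l ?pnorm_ge0.
Qed.

Lemma pnorm_le r s p : 0 <= r -> r <= s -> pnorm r p <= pnorm s p.
Proof.
move=> r0 rs; apply: ler_sum => i _; rewrite ler_wpM2l// lerXn2r// nnegrE//.
exact: le_trans rs.
Qed.

Lemma horner_pnorm r p t : `|t| <= r -> `|p.[t]| <= pnorm r p.
Proof.
move=> tr; have r0 : 0 <= r by apply: le_trans tr.
rewrite horner_coef (le_trans (ler_norm_sum _ _ _))//; apply: ler_sum => i _.
by rewrite normrM normrX ler_wpM2l// lerXn2r.
Qed.

Lemma coef_pnorm p i : `|p`_i| <= pnorm 1 p.
Proof.
have [h|/(nth_default _) ->] := ltnP i (size p); last by rewrite normr0 pnorm_ge0.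
rewrite /pnorm (bigD1 (Ordinal h)) //= expr1n mulr1 lerDl.
by apply: sumr_ge0 => j _; rewrite mulr_ge0// exprn_ge0.
Qed.

(** The left side is a single term of the binomial expansion of the right side. *)
Lemma natmul_exprn_le r s n : 0 <= r -> 0 < s -> n%:R * r ^+ n.-1 * s <= (r + s) ^+ n.
Proof.
move=> r0 s0; have rs0 : 0 <= r + s by rewrite addr_ge0// ltW.
case: n => [|n] /=; first by rewrite !mul0r expr0.
elim: n => [|n ih]; first by rewrite mul1r expr0 mul1r expr1 lerDr.
rewrite [leRHS]exprS; apply: (@le_trans _ _ (r * (n.+1%:R * r ^+ n * s) + s * (r ^+ n.+1))).
  by rewrite [X in X <= _](_ : _ = r * (n.+1%:R * r ^+ n * s) + s * r ^+ n.+1)// -[n.+2%:R]nat1r exprS; ring.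
rewrite mulrDl lerD// ler_wpM2l//; first exact: ltW.
by rewrite lerXn2r// lerDl ltW.
Qed.

(** Cauchy's estimate: a derivative is paid for by enlarging the radius by [s]. The preceding
    inequality is applied to each coefficient. *)
Lemma pnorm_deriv r s p : 0 <= r -> 0 < s -> pnorm r p^`() <= pnorm (r + s) p / s.
Proof.
move=> r0 s0; rewrite ler_pdivlMr//.
rewrite (@pnormE _ _ (size p)); last by rewrite (leq_trans (size_poly _ _))// leq_pred.
rewrite (@pnormE _ p (size p).+1)// [leRHS]big_ord_recl /= mulr_suml.
apply: (@le_trans _ _ (\sum_(i < size p) `|p`_(lift ord0 i)| * (r + s) ^+ lift ord0 i)); last first.
  by rewrite lerDr mulr_ge0// expr0.
apply: ler_sum => i _; rewrite lift0 coef_deriv normrMn -mulr_natl.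
rewrite (_ : _ * s = `|p`_i.+1| * (i.+1%:R * r ^+ i * s)); last by ring.
by rewrite ler_wpM2l// (natmul_exprn_le i.+1).
Qed.

(** At [i = 0] the coefficient is a division by zero, which is 0 by convention; so this is the
    primitive that vanishes at 0. *)
Definition prim p : {poly R} := \poly_(i < (size p).+1) (p`_i.-1 / i%:R).

Lemma deriv_prim p : (prim p)^`() = p.
Proof.
apply/polyP => i; rewrite coef_deriv coef_poly ltnS /=.
case: ltnP => [_|/(nth_default _) ->]; last by rewrite mul0rn.
by rewrite -[LHS]mulr_natr divfK// pnatr_eq0.
Qed.

Lemma prim0 p : (prim p).[0] = 0.
Proof. by rewrite horner_coef0 coef_poly /= invr0 mulr0. Qed.

Lemma pnorm_prim r p : 0 <= r -> pnorm r (prim p) <= r * pnorm r p.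
Proof.
move=> r0; rewrite (@pnormE _ _ (size p).+1) ?size_poly// big_ord_recl /=.
rewrite coef_poly /= invr0 mulr0 normr0 mul0r add0r mulr_sumr.
apply: ler_sum => i _; rewrite /bump leq0n add1n coef_poly /= ltnS ltn_ord exprS mulrCA.
rewrite normrM normfV ler_wpM2l// ler_wpM2r ?exprn_ge0//.
by rewrite ler_pdivrMr ?normr_gt0 ?pnatr_eq0// normr_nat ler_peMr// ler1n.
Qed.

(** Recentring costs the modulus of [c] in radius. It gives the power series of the limit at points
    other than 0. *)
Lemma pnorm_comp r p (c : R) : 0 <= r ->
  pnorm r (p \Po ('X + c%:P)) <= pnorm (r + `|c|) p.
Proof.
move=> r0; rewrite comp_polyE (le_trans (pnorm_sum _ _ _ r0))//.
apply: ler_sum => i _; rewrite (le_trans (pnormZ _ _ r0))// ler_wpM2l//.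
rewrite (le_trans (pnorm_exp _ _ r0))// lerXn2r// ?nnegrE ?pnorm_ge0 ?addr_ge0//.
by rewrite (le_trans (pnormD _ _ r0))// pnormX// pnormC.
Qed.

End PolyNorm.

(** * Limits of polynomials are real analytic *)

Section PolyLimit.
Context {R : realType}.
Implicit Types (P : nat -> {poly R}).

Lemma real_cauchy_cvg (u : nat -> R) :
  (forall e, 0 < e -> exists K, forall j k, (K <= j)%N -> (K <= k)%N -> `|u j - u k| <= e) ->
  cvgn u.
Proof.
move=> h; apply/cauchy_cvgP/cauchy_exP => _/posnumP[e].
have [K hK] := h (e%:num / 2) ltac:(by []).
exists (u K); exists K => // k /= Kk.
by rewrite /ball /= (le_lt_trans (hK K k _ _))// ltr_pdivrMr// ltr_pMr// ltr1n.
Qed.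

(** All radii are required, so this amounts to uniform Cauchy convergence on every complex disc: the
    limit is entire. *)
Definition pcauchy P := forall r e : R, 0 <= r -> 0 < e ->
  exists K, forall j k, (K <= j)%N -> (K <= k)%N -> pnorm r (P j - P k) <= e.

Lemma pcauchy_deriv P : pcauchy P -> pcauchy (fun k => (P k)^`()).
Proof.
move=> h r e r0 e0; have [K hK] := h (r + 1) e ltac:(by rewrite addr_ge0) e0.
exists K => j k Kj Kk; rewrite -derivB (le_trans (pnorm_deriv _ r0 (@ltr01 R)))//.
by rewrite divr1 hK.
Qed.

Lemma pcauchy_comp P c : pcauchy P -> pcauchy (fun k => P k \Po ('X + c%:P)).
Proof.
move=> h r e r0 e0; have [K hK] := h (r + `|c|) e ltac:(by rewrite addr_ge0) e0.
by exists K => j k Kj Kk; rewrite -raddfB (le_trans (pnorm_comp _ _ r0))// hK.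
Qed.

Lemma pcauchy_derivn P n : pcauchy P -> pcauchy (fun k => (P k)^`(n)).
Proof.
move=> h; elim: n => [|n /pcauchy_deriv]; first by under eq_fun do rewrite derivn0.
by under [in X in _ -> X]eq_fun do rewrite derivnS.
Qed.

Lemma pcauchy_cvg P t : pcauchy P -> cvgn (fun k => (P k).[t]).
Proof.
move=> h; apply: real_cauchy_cvg => e e0; have [K hK] := h `|t| e ltac:(by []) e0.
by exists K => j k Kj Kk; rewrite -hornerN -hornerD (le_trans (horner_pnorm _ (lexx _)))// hK.
Qed.

Lemma pcauchy_coef_cvg P i : pcauchy P -> cvgn (fun k => (P k)`_i).
Proof.
move=> h; apply: real_cauchy_cvg => e e0; have [K hK] := h 1 e ltac:(by []) e0.
by exists K => j k Kj Kk; rewrite -coefB (le_trans (coef_pnorm _ _))// hK.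
Qed.

Definition plim P (t : R) : R := limn (fun k => (P k).[t]).
Definition coef_lim P (i : nat) : R := limn (fun k => (P k)`_i).

Lemma horner_sum_take (p : {poly R}) t m : (size p <= m)%N ->
  p.[t] = \sum_(0 <= i < m) p`_i * t ^+ i.
Proof. by move=> h; rewrite big_mkord (horner_coef_wide _ h). Qed.

(** For fixed [m] the finite sum is the limit over [j] of truncations of [pnorm r (P k - P j)], so
    the Cauchy bound passes to it. The bound does not depend on [m]. *)
Lemma coef_lim_tail P r e : pcauchy P -> 0 <= r -> 0 < e -> exists K, forall k m,
  (K <= k)%N -> \sum_(0 <= i < m) `|(P k)`_i - coef_lim P i| * r ^+ i <= e.
Proof.
move=> h r0 e0; have [K hK] := h r e r0 e0; exists K => k m Kk.
have cv : (fun j => \sum_(0 <= i < m) `|(P k)`_i - (P j)`_i| * r ^+ i) @ \oo -->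
    \sum_(0 <= i < m) `|(P k)`_i - coef_lim P i| * r ^+ i.
  rewrite big_mkord; under eq_fun do rewrite big_mkord.
  apply: cvg_big; first exact: add_continuous.
  move=> i _; apply: cvgMl; apply: cvg_norm; apply: cvgB; first exact: cvg_cst.
  exact: pcauchy_coef_cvg.
apply: (cvgr_to_le cv); exists K => // j /= Kj.
apply: le_trans (hK k j Kk Kj).
set p := P k; set q := P j.
rewrite (@pnormE _ _ _ (maxn m (size (p - q)))) ?leq_maxr//.
rewrite big_mkord (big_ord_widen _ (fun i => `|p`_i - q`_i| * r ^+ i) (leq_maxl m (size (p - q)))).
rewrite big_mkcond /=; apply: ler_sum => i _; rewrite coefB.
by case: ifP => // _; rewrite mulr_ge0// exprn_ge0.
Qed.

Lemma plim_dist P t r e k : pcauchy P -> `|t| <= r ->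
  (forall j, (k <= j)%N -> pnorm r (P j - P k) <= e) -> `|plim P t - (P k).[t]| <= e.
Proof.
move=> h tr hk.
have cv : (fun j => `|(P j).[t] - (P k).[t]|) @ \oo --> `|plim P t - (P k).[t]|.
  by apply: cvg_norm; apply: cvgB; [exact: pcauchy_cvg|exact: cvg_cst].
apply: (cvgr_to_le cv); exists k => // j /= kj.
by rewrite -hornerN -hornerD (le_trans (horner_pnorm _ tr))// hk.
Qed.

Lemma plim_pseries P t : pcauchy P -> pseries (coef_lim P) t @ \oo --> plim P t.
Proof.
move=> h; apply/cvgrPdist_le => e e0.
have e20 : 0 < e / 2 by rewrite divr_gt0.
have [K1 hK1] := h `|t| _ ltac:(by []) e20.
have [K2 hK2] := coef_lim_tail h (normr_ge0 t) e20.
pose k := maxn K1 K2.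
(* From this index on, the partial sums of [P k] equal its value, so only the coefficient
   differences remain to be bounded. *)
exists (size (P k)) => // m /= km.
have h1 : `|plim P t - (P k).[t]| <= e / 2.
  apply: plim_dist (lexx _) _ => // j kj.
  by rewrite hK1// ?(leq_trans _ kj)// leq_maxl.
have h2 : `|(P k).[t] - pseries (coef_lim P) t m| <= e / 2.
  apply: le_trans (hK2 k m (leq_maxr _ _)).
  rewrite (horner_sum_take _ km) /pseries /series /= -sumrB (le_trans (ler_norm_sum _ _ _))//.
  by apply: ler_sum => i _; rewrite -mulrBl normrM normrX.
rewrite (splitr e) (le_trans _ (lerD h1 h2))// (le_trans _ (ler_normD _ _))//.
by rewrite subrKA.
Qed.

Lemma plim_analytic P : pcauchy P -> real_analytic (plim P).
Proof.
move=> h t0; pose Q k := P k \Po ('X + t0%:P).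
exists (coef_lim Q); near=> t.
rewrite (_ : plim P t = plim Q (t - t0)).
  by apply: plim_pseries; exact: pcauchy_comp.
rewrite /plim; congr (limn _); apply/funext => k.
by rewrite /Q horner_comp !hornerE subrK.
Unshelve. all: by end_near. Qed.

Lemma is_derive_plim P (t : R) : pcauchy P -> is_derive t (1 : R) (plim P) (plim (fun k => (P k)^`()) t).
Proof.
move=> h; have hE Q s : pcauchy Q -> plim Q s = limn (pseries (coef_lim Q) s).
  by move=> hQ; apply/esym/cvg_lim => //; exact: plim_pseries.
have dE Q : pcauchy Q -> coef_lim (fun k => (Q k)^`()) = pseries_diffs (coef_lim Q).
  move=> hQ; apply/funext => i; rewrite /coef_lim /pseries_diffs.
  apply/cvg_lim => //; under eq_fun do rewrite coef_deriv -mulr_natl.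
  by apply: cvgMr; exact: pcauchy_coef_cvg.
have -> : plim P = (fun s => limn (pseries (coef_lim P) s)) by apply/funext => s; exact: hE.
have h1 := pcauchy_deriv h; have h2 := pcauchy_deriv h1.
rewrite (hE _ _ h1) (dE _ h).
(* Termwise differentiation asks that the series and its first two formal derivatives converge at a
   point of larger modulus; any such point serves, as the limit is entire. *)
have tt : `|t| < `|(`|t| + 1)| by rewrite (@ger0_norm _ (`|t| + 1)) ?addr_ge0// ltrDl.
apply: pseries_snd_diffs tt.
- by apply/cvg_ex; eexists; exact: plim_pseries h.
- by rewrite -(dE _ h); apply/cvg_ex; eexists; exact: plim_pseries h1.
- by rewrite -(dE _ h) -(dE _ h1); apply/cvg_ex; eexists; exact: plim_pseries h2.
Qed.

End PolyLimit.

(** * Polynomial approximation with small coefficient norm *)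

Section Approximation.
Context {R : realType}.

(** The constraint [0 <= g] cuts a compact set out of the square, and [f] attains its minimum there.
    The constraint serves to remove a neighbourhood of the diagonal, where separation fails. *)
Lemma square_lower_bound (c : R) (f g : R * R -> R) : continuous f -> continuous g ->
  (forall s t, `|s| <= c -> `|t| <= c -> 0 <= g (s, t) -> 0 < f (s, t)) ->
  exists2 d, 0 < d & forall s t, `|s| <= c -> `|t| <= c -> 0 <= g (s, t) -> d <= f (s, t).
Proof.
move=> cf cg h.
pose A : set (R * R) := (`[- c, c] `*` `[- c, c]) `&` (g @^-1` [set x | 0 <= x]).
have inA s t : A (s, t) <-> [/\ `|s| <= c, `|t| <= c & 0 <= g (s, t)].
  by rewrite /A /= !in_itv /= -!ler_norml; split=> [[[]]|[]].
have cA : compact A.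
  apply: compact_closedI; first by apply: compact_setX; exact: segment_compact.
  by apply: preimage_closed => [p _|]; [exact: cg|exact: closed_ge].
have [A0|A0] := pselect (A !=set0); last first.
  by exists 1 => // s t hs ht hg; exfalso; apply: A0; exists (s, t); exact/inA.
have [[s t] /set_mem/inA[hs ht hg] hm] := compact_EVT_min A0 cA (continuous_subspaceT cf).
exists (f (s, t)); first exact: h.
by move=> s' t' *; apply: hm; apply/mem_set/inA.
Qed.

(** By contraposition: on the compact set of pairs where [h] varies by at least [e], the distance
    between the two points is positive, hence bounded below. *)
Lemma segment_unif_cont (c e : R) (h : R -> R) : continuous h -> 0 < e ->
  exists2 d, 0 < d & forall s t, `|s| <= c -> `|t| <= c -> `|s - t| < d -> `|h s - h t| < e.
Proof.
move=> ch e0.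
have c1 : continuous (fun p : R * R => `|p.1 - p.2|).
  by move=> p; apply: cvg_norm; apply: cvgB; [exact: cvg_fst|exact: cvg_snd].
have c2 : continuous (fun p : R * R => `|h p.1 - h p.2| - e).
  move=> p; apply: cvgB; last exact: cvg_cst.
  by apply: cvg_norm; apply: cvgB;
    [apply: continuous_comp; [exact: cvg_fst|exact: ch]
    |apply: continuous_comp; [exact: cvg_snd|exact: ch]].
have [s t _ _|d d0 hd] := square_lower_bound (c := c) c1 c2.
  rewrite /= subr_ge0 normr_gt0 subr_eq0; apply: contraTneq => ->.
  by rewrite subrr normr0 -ltNge.
exists d => // s t hs ht; apply: contraTT; rewrite -!leNgt => h1.
by apply: hd => //=; rewrite subr_ge0.
Qed.

Lemma segment_bounded (c : R) (h : R -> R) : continuous h ->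
  exists2 M : R, 0 <= M & forall t, `|t| <= c -> `|h t| <= M.
Proof.
move=> ch; have [c0|c0] := leP 0 c; last first.
  by exists 0 => // t tc; have := le_trans (normr_ge0 t) tc; rewrite leNgt c0.
have cn : {within `[- c, c], continuous (fun t => `|h t|)}.
  by apply: continuous_subspaceT => t; apply: cvg_norm; exact: ch.
have [m _ hm] := EVT_max (a := - c) (b := c) ltac:(by rewrite ge0_cp) cn.
by exists `|h m| => // t tc; apply: hm; rewrite in_itv /= -ler_norml.
Qed.

(* Bernstein's operator, computed by Pascal's recursion instead of binomial
   coefficients: the expectation of [g] under the binomial law. *)
Fixpoint bernstein (u : {poly R}) (n : nat) (g : nat -> R) : {poly R} :=
  if n is n'.+1 then u * bernstein u n' (g \o S) + (1 - u) * bernstein u n' g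
  else (g 0%N)%:P.

(** Chebyshev's argument: a quadratic bound around [a] is averaged, and the second moment of the
    binomial law about [a] is squared bias plus variance. The centre [a] is arbitrary because a
    success in the first trial shifts it by one in the induction. *)
Lemma bernstein_dist (u : {poly R}) (t w A K a : R) n (g : nat -> R) :
  0 <= u.[t] <= 1 ->
  (forall i, (i <= n)%N -> `|g i - w| <= A + K * (i%:R - a) ^+ 2) ->
  `|(bernstein u n g).[t] - w| <=
    A + K * ((n%:R * u.[t] - a) ^+ 2 + n%:R * (u.[t] * (1 - u.[t]))).
Proof.
move=> /andP[u0 u1]; elim: n g a => [|n ih] g a h /=.
  by rewrite hornerC mul0r mul0r addr0 h.
rewrite hornerD !hornerM hornerD hornerN (hornerC 1).
have h1 := ih (g \o S) (a - 1) _.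
have h2 := ih g a _.
set b1 := (bernstein _ _ _).[t] in h1 *; set b2 := (bernstein u n g).[t] in h2 *.
set v := u.[t] in u0 u1 h1 h2 *.
have -> : v * b1 + (1 - v) * b2 - w = v * (b1 - w) + (1 - v) * (b2 - w) by ring.
have v1 : 0 <= 1 - v by rewrite subr_ge0.
apply: (@le_trans _ _ (v * `|b1 - w| + (1 - v) * `|b2 - w|)).
  by rewrite (le_trans (ler_normD _ _))// !normrM (ger0_norm u0) (ger0_norm v1).
apply: le_trans (lerD (ler_wpM2l u0 (h1 _)) (ler_wpM2l v1 (h2 _))) _.
- move=> i hi /=; apply: le_trans (h i.+1 hi) _.
  by rewrite -nat1r le_eqVlt; apply/orP; left; apply/eqP; ring.
- by move=> i hi /=; rewrite h// leqW.
by rewrite -nat1r le_eqVlt; apply/orP; left; apply/eqP; ring.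
Qed.

Lemma weierstrass (h : R -> R) (c e : R) : continuous h -> 0 < c -> 0 < e ->
  exists p : {poly R}, forall t, `|t| <= c -> `|p.[t] - h t| <= e.
Proof.
move=> ch c0 e0.
have [M M0 hM] := segment_bounded c ch.
have [d d0 hd] := segment_unif_cont c ch (divr_gt0 e0 (ltr0n R 2)).
have e20 : 0 < e / 2 by rewrite divr_gt0.
(* With the [K] below, the variance term [K * (n * (v * (1 - v)))] equals
   [B / n * (v * (1 - v))]. *)
pose B := 8 * M * c ^+ 2 / d ^+ 2.
have B0 : 0 <= B by rewrite !mulr_ge0 ?invr_ge0 ?exprn_ge0// ltW.
pose n := (Num.trunc (B / (e / 2))).+1.
have nB : B / n%:R <= e / 2.
  by rewrite ler_pdivrMr ?ltr0n// mulrC -ler_pdivrMr// ltW// truncnS_gt.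
pose u : {poly R} := (2 * c)^-1 *: ('X + c%:P).
pose node i : R := 2 * c * (i%:R / n%:R) - c.
exists (bernstein u n (h \o node)) => t tc.
have ut : u.[t] = (t + c) / (2 * c) by rewrite /u !hornerE mulrC.
have /andP[tc1 tc2] : - c <= t <= c by rewrite -ler_norml.
have u01 : 0 <= u.[t] <= 1.
  have tc0 : 0 <= t + c by rewrite -lerBlDr sub0r.
  rewrite ut divr_ge0 ?mulr_ge0 ?(ltW c0)//=.
  by rewrite ler_pdivrMr ?mulr_gt0// mul1r mulr_natl mulr2n lerD2r.
have n0 : n%:R != 0 :> R by rewrite pnatr_eq0.
(* Chosen so that the quadratic term is [2 * M] times the square of [(node i - t) / d]. It then
   covers the trivial bound [2 * M] when the node is at distance at least [d], while uniform
   continuity covers the near nodes. *)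
pose K := 2 * M / d ^+ 2 * (2 * c / n%:R) ^+ 2.
apply: le_trans (bernstein_dist (A := e / 2) (K := K) (a := n%:R * u.[t]) u01 _) _.
  move=> i ni /=.
  have nodec : `|node i| <= c.
    have i0 : 0 <= i%:R / n%:R :> R by rewrite divr_ge0.
    have i1 : i%:R / n%:R <= 1 :> R by rewrite ler_pdivrMr ?ltr0n// mul1r ler_nat.
    rewrite ler_norml /node; apply/andP; split; first by rewrite lerBrDr addNr mulr_ge0// mulr_ge0// ltW.
    by rewrite lerBlDr; nra.
  have E : node i - t = 2 * c / n%:R * (i%:R - n%:R * u.[t]).
    by rewrite ut /node; field; rewrite n0 gt_eqF.
  rewrite (_ : K * _ = 2 * M / d ^+ 2 * (node i - t) ^+ 2); last by rewrite E /K; ring.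
  have K0 : 0 <= 2 * M / d ^+ 2 * (node i - t) ^+ 2.
    by rewrite mulr_ge0 ?sqr_ge0// mulr_ge0 ?invr_ge0 ?sqr_ge0// mulr_ge0.
  have [sd|sd] := ltP `|node i - t| d.
    by rewrite (le_trans (ltW (hd _ _ nodec tc sd)))// lerDl.
  rewrite (@le_trans _ _ (2 * M))//.
    rewrite (le_trans (ler_normB _ _))// (le_trans (lerD (hM _ nodec) (hM _ tc)))//.
    by rewrite mulr_natl mulr2n.
  rewrite (ler_wpDl (ltW e20))// [leRHS]mulrAC ler_pdivlMr ?exprn_gt0// ler_wpM2l ?mulr_ge0//.
  by rewrite -[leRHS]real_normK ?num_real// lerXn2r// nnegrE (ltW d0).
rewrite subrr expr0n /= add0r [leRHS]splitr lerD2l.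
apply: le_trans nB.
rewrite (_ : K * _ = B / n%:R * (u.[t] * (1 - u.[t]))); last by rewrite /K /B; field; rewrite n0 gt_eqF.
rewrite ler_piMr ?divr_ge0//; move: u01; set v := u.[t] => /andP[v0 v1]; nra.
Qed.

Lemma bernoulli_ineq (x : R) n : -1 <= x -> 1 + n%:R * x <= (1 + x) ^+ n.
Proof.
move=> x1; elim: n => [|n ih]; first by rewrite mul0r addr0 expr0.
have x0 : 0 <= 1 + x by rewrite -lerBlDl sub0r.
rewrite exprS; apply: le_trans (ler_wpM2l x0 ih).
have -> : (1 + x) * (1 + n%:R * x) = 1 + n.+1%:R * x + n%:R * x ^+ 2 by rewrite -nat1r; ring.
by rewrite lerDl mulr_ge0// sqr_ge0.
Qed.

Lemma exists_small_expr (q d : R) : 0 <= q -> q < 1 -> 0 < d -> exists n, q ^+ n <= d.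
Proof.
move=> q0 q1 d0.
have /cvgrPdist_le/(_ d d0)[n _ /(_ n (leqnn n))] : GRing.exp q n @[n --> \oo] --> (0 : R).
  by apply: cvg_expr; rewrite ger0_norm.
by rewrite /= sub0r normrN ger0_norm ?exprn_ge0//; exists n.
Qed.

(* The threshold is [1 - (1 - v^a)^b] with [v = (t/c)^2] and [b] close to
   [(c^2/(rs))^a]; Bernoulli's inequality bounds both sides. *)
Lemma threshold (r s c d : R) : 0 < r -> r < s -> s <= c -> 0 < d ->
  exists p : {poly R}, [/\ pnorm r p <= d,
    forall t, `|t| <= c -> 0 <= p.[t] <= 1 &
    forall t, s <= `|t| -> `|t| <= c -> 1 - p.[t] <= d].
Proof.
move=> r0 rs sc d0.
have s0 : 0 < s by rewrite (lt_trans r0).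
have c0 : 0 < c by rewrite (lt_le_trans s0).
pose q := r / s.
have q0 : 0 < q by rewrite divr_gt0.
have q1 : q < 1 by rewrite ltr_pdivrMr// mul1r.
have d40 : 0 < Num.min d 1 / 4 by rewrite divr_gt0// lt_min d0 ltr01.
have [a qa] := exists_small_expr (ltW q0) q1 d40.
have [qd q4] : q ^+ a <= d / 4 /\ q ^+ a <= 1 / 4.
  by split; rewrite (le_trans qa)// ler_pM2r ?invr_gt0// ge_min lexx ?orbT.
(* The geometric mean of the inverses of [A] and [S] below, so that [g * A] is the small number
   [q ^+ a] and [g * S] is its inverse; [b] is [g] rounded up, at the price of a factor 2. *)
pose g := (c ^+ 2 / (r * s)) ^+ a.
have g1 : 1 <= g.
  rewrite exprn_ege1// ler_pdivlMr ?mulr_gt0// mul1r expr2 ler_pM ?(ltW r0) ?(ltW s0)//.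
  by rewrite (le_trans (ltW rs)).
pose b := (Num.trunc g).+1.
have gb : g <= b%:R by rewrite ltW// truncnS_gt.
have b2g : b%:R <= 2 * g.
  rewrite mulr_natl mulr2n /b -nat1r lerD// truncn_le// (le_trans _ g1)//.
pose A := ((r / c) ^+ 2) ^+ a.
pose S := ((s / c) ^+ 2) ^+ a.
have A0 : 0 <= A by rewrite exprn_ge0 ?sqr_ge0.
have S0 : 0 <= S by rewrite exprn_ge0 ?sqr_ge0.
have gA : g * A = q ^+ a.
  by rewrite -exprMn; congr (_ ^+ a); rewrite /q; field; rewrite !gt_eqF.
have gS : g * S = q ^- a.
  by rewrite -exprVn -exprMn; congr (_ ^+ a); rewrite /q; field; rewrite !gt_eqF.
have bA : b%:R * A <= 2 * q ^+ a by rewrite -gA mulrA ler_wpM2r.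
have bS : q ^- a <= b%:R * S by rewrite -gS ler_wpM2r.
pose w : {poly R} := ((c ^+ 2)^-1 *: 'X^2) ^+ a.
have wE t : w.[t] = ((t / c) ^+ 2) ^+ a.
  by rewrite /w horner_exp hornerZ hornerXn; congr (_ ^+ a); rewrite [RHS]exprMn exprVn mulrC.
have w01 t : `|t| <= c -> 0 <= w.[t] <= 1.
  move=> tc; rewrite wE exprn_ge0 ?sqr_ge0//= exprn_ile1 ?sqr_ge0//.
  rewrite -real_normK ?num_real// exprn_ile1// normrM normfV (gtr0_norm c0).
  by rewrite ler_pdivrMr// mul1r.
have wA : pnorm r w <= A.
  rewrite (le_trans (pnorm_exp _ _ (ltW r0)))// lerXn2r ?nnegrE ?pnorm_ge0 ?sqr_ge0 ?(ltW r0)//.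
  rewrite (le_trans (pnormZ _ _ (ltW r0)))// pnormXn ?(ltW r0)// ger0_norm ?invr_ge0 ?sqr_ge0//.
  by rewrite exprMn exprVn mulrC.
exists (1 - (1 - w) ^+ b); split.
- have -> : 1 - (1 - w) ^+ b = w * \sum_(i < b) (1 - w) ^+ i.
    by rewrite -[LHS]opprB subrX1 addrAC subrr add0r mulNr opprK.
  have r0' := ltW r0.
  have h1w : pnorm r (1 - w) <= 1 + A.
    rewrite (le_trans (pnormB _ _ r0'))// lerD//.
    by rewrite -[1]/(1%:P) pnormC normr1.
  (* Bernoulli gives a lower bound 1/2 for the power of [1 - A]; the product of [1 + A] and [1 - A]
     being at most 1 turns it into this upper bound. *)
  have h2 : (1 + A) ^+ b <= 2.
    have A1 : A <= 1.
      rewrite exprn_ile1 ?sqr_ge0// exprn_ile1 ?divr_ge0 ?(ltW c0)//.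
      by rewrite ler_pdivrMr// mul1r (le_trans (ltW rs)).
    have h3 : 1 / 2 <= (1 - A) ^+ b.
      apply: le_trans (bernoulli_ineq b (x := - A) _); last by rewrite lerN2.
      by move: bA q4; rewrite mulrN; lra.
    have h4 : (1 + A) ^+ b * (1 - A) ^+ b <= 1.
      rewrite -exprMn exprn_ile1//.
        by rewrite mulr_ge0 ?subr_ge0// addr_ge0.
      by rewrite mulrC -subr_sqr expr1n lerBlDr lerDl sqr_ge0.
    have h5 : 0 <= (1 + A) ^+ b by rewrite exprn_ge0// addr_ge0.
    nra.
  have h3 : pnorm r (\sum_(i < b) (1 - w) ^+ i) <= b%:R * 2.
    rewrite (le_trans (pnorm_sum _ _ _ r0'))//.
    rewrite mulr_natl -[X in _ <= _ *+ X](card_ord b) -sumr_const ler_sum// => i _.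
    rewrite (le_trans (pnorm_exp _ _ r0'))//.
    apply: (@le_trans _ _ ((1 + A) ^+ i)).
      by rewrite lerXn2r ?nnegrE ?pnorm_ge0 ?addr_ge0.
    by rewrite (le_trans _ h2)// ler_weXn2l ?lerDl// ltnW.
  rewrite (le_trans (pnormM _ _ r0'))//.
  apply: (@le_trans _ _ (A * (b%:R * 2))); first by rewrite ler_pM ?pnorm_ge0.
  by move: bA qd; rewrite mulrA [A * _]mulrC; lra.
- move=> t /w01 /andP[w0 w1].
  rewrite hornerD hornerN horner_exp hornerD hornerN !(hornerC 1).
  have v0 : 0 <= 1 - w.[t] by rewrite subr_ge0.
  apply/andP; split; last by rewrite lerBlDr lerDl exprn_ge0.
  by rewrite subr_ge0 exprn_ile1// lerBlDr lerDl.
- move=> t st /w01 /andP[w0 w1].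
  rewrite hornerD hornerN horner_exp hornerD hornerN !(hornerC 1) subKr.
  have Sw : S <= w.[t].
    rewrite wE lerXn2r ?nnegrE ?sqr_ge0// -[leRHS]real_normK ?num_real//.
    rewrite lerXn2r ?nnegrE ?divr_ge0 ?(ltW c0) ?(ltW s0)//.
    by rewrite normrM normfV (gtr0_norm c0) ler_pM2r ?invr_gt0.
  set v := w.[t] in w0 w1 Sw *.
  (* The same trick in the other direction: Bernoulli makes the power of [1 + v] large, which forces
     the power of [1 - v] to be small. *)
  have h1 : (1 - v) ^+ b * (1 + v) ^+ b <= 1.
    rewrite -exprMn exprn_ile1 ?mulr_ge0 ?subr_ge0 ?addr_ge0//.
    by rewrite -subr_sqr expr1n lerBlDr lerDl sqr_ge0.
  have h2 : q ^- a <= (1 + v) ^+ b.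
    have := bernoulli_ineq b (x := v) ltac:(by rewrite (le_trans _ w0)// lerN10).
    apply: le_trans; rewrite (le_trans bS)// ler_wpDl// ler_wpM2l//.
  have h3 : (1 - v) ^+ b * q ^- a <= 1.
    by rewrite (le_trans _ h1)// ler_wpM2l// exprn_ge0// subr_ge0.
  have qa0 : 0 < q ^+ a by rewrite exprn_gt0.
  move: h3; rewrite ler_pdivrMr// mul1r => h3.
  by rewrite (le_trans h3)// (le_trans qd)// ler_pdivrMr// ler_peMr ?(ltW d0)// ler1n.
Qed.

(* A Weierstrass approximation times a threshold. *)
Lemma approx_vanishing (h : R -> R) (r s c e : R) : continuous h ->
  0 < r -> r < s -> s <= c -> 0 < e -> (forall t, `|t| <= s -> h t = 0) ->
  exists2 p : {poly R}, pnorm r p <= e & forall t, `|t| <= c -> `|p.[t] - h t| <= e.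
Proof.
move=> ch r0 rs sc e0 h0.
have c0 : 0 < c by rewrite (lt_le_trans _ sc)// (lt_trans r0).
have e20 : 0 < e / 2 by rewrite divr_gt0.
have [q hq] := weierstrass ch c0 e20.
pose B := pnorm c q + 1.
have B0 : 0 < B by rewrite ltr_wpDl// pnorm_ge0// ltW.
have [p [p1 p2 p3]] := threshold r0 rs sc (divr_gt0 e20 B0).
have qB : pnorm r q <= B.
  by rewrite (le_trans (pnorm_le _ (ltW r0) (le_trans (ltW rs) sc)))// lerDl.
have ee : e / 2 <= e by rewrite ler_pdivrMr// ler_peMr ?ler1n// ltW.
exists (q * p).
  rewrite (le_trans (pnormM _ _ (ltW r0)))// (le_trans _ ee)//.
  rewrite (le_trans (ler_pM _ _ qB p1)) ?pnorm_ge0 ?(ltW r0)//.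
  by rewrite mulrC divfK// gt_eqF.
move=> t tc; rewrite hornerM.
have /andP[p0 pl1] := p2 t tc.
have [ts|ts] := leP `|t| s.
  rewrite h0// subr0 normrM (ger0_norm p0) (le_trans _ ee)//.
  rewrite (le_trans (ler_piMr _ pl1))//.
  by have := hq t tc; rewrite h0// subr0.
rewrite (_ : _ - _ = (q.[t] - h t) - q.[t] * (1 - p.[t])); last by ring.
rewrite (le_trans (ler_normB _ _))// [leRHS]splitr lerD ?hq//.
rewrite normrM (ger0_norm (_ : 0 <= 1 - p.[t])) ?subr_ge0//.
apply: (@le_trans _ _ (B * (e / 2 / B))); last by rewrite mulrC divfK// gt_eqF.
rewrite ler_pM ?subr_ge0 ?p3 ?(ltW ts)//.
by rewrite (le_trans (horner_pnorm _ tc))// lerDl.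
Qed.

End Approximation.

(** * A differentiable step function *)

Section Bump.
Context {R : realType}.

Lemma is_derive_posr_sqr (u : R) :
  is_derive u (1 : R) (fun v => Num.max 0 v ^+ 2) (2 * Num.max 0 u).
Proof.
have h : (fun h : R => h^-1 *: (((fun v => Num.max 0 v ^+ 2) \o shift u) (h *: (1 : R)) -
    Num.max 0 u ^+ 2)) @ 0^' --> 2 * Num.max 0 u.
  apply/cvgrPdist_le => e e0; near=> h.
  have h0 : h != 0 by near: h; exact: nbhs_dnbhs_neq.
  have he : `|h| <= e by near: h; apply: dnbhs0_le.
  apply: le_trans he; rewrite /= [h%:A]mulr1 /GRing.scale /=.
  set m := Num.max 0 u; set m' := Num.max 0 (h + u).
  have -> : 2 * m - h^-1 * (m' ^+ 2 - m ^+ 2) = h^-1 * (2 * m * h - (m' ^+ 2 - m ^+ 2)) by field.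
  rewrite normrM normfV mulrC ler_pdivrMr ?normr_gt0// -normrM -expr2 (ger0_norm (sqr_ge0 _)) ler_norml.
  rewrite /m /m'; case: (leP 0 u) => u0; case: (leP 0 (h + u)) => hu0; apply/andP; split; nra.
by constructor; [apply/cvg_ex; eexists; exact: h|exact/cvg_lim].
Unshelve. all: by end_near. Qed.

Lemma is_derive_continuous (f df : R -> R) :
  (forall t : R, is_derive t (1 : R) f (df t)) -> continuous f.
Proof.
by move=> hf x; apply/differentiable_continuous/derivable1_diffP; exact: (@ex_derive _ _ _ _ _ _ _ (hf x)).
Qed.

Lemma mvt_bound (f df : R -> R) (c b : R) : (forall t : R, is_derive t (1 : R) f (df t)) ->
  (forall t, `|t| <= c -> `|df t| <= b) ->
  forall t, `|t| <= c -> `|f t - f 0| <= b * `|t|.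
Proof.
move=> hf hb t tc.
have cf := is_derive_continuous hf.
have [t0|t0] := leP 0 t.
  have [x] := MVT_segment t0 (fun x _ => hf x) (continuous_subspaceT cf).
  rewrite in_itv /= => /andP[x0 xt] ->; rewrite subr0 normrM ler_wpM2r// hb//.
  by rewrite ger0_norm// (le_trans xt)// (le_trans (ler_norm _)).
have [x] := MVT_segment (ltW t0) (fun x _ => hf x) (continuous_subspaceT cf).
rewrite in_itv /= => /andP[x0 xt] E; rewrite distrC E sub0r normrM normrN ler_wpM2r// hb//.
by rewrite ler0_norm// (le_trans _ tc)// ltr0_norm// lerN2.
Qed.

(** The polynomial [threshold] is only small near 0, whereas [approx_vanishing] wants functions that
    are exactly zero there. The squared positive part of [t ^+ 2 - r ^+ 2] is differentiable and has
    this property; a rational function of it brings the values into [0, 1]. The bound on the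
    derivative is for the integration by parts. *)
Lemma smooth_step (r s c d : R) : 0 < r -> r < s -> 0 < d ->
  exists w dw : R -> R, [/\ forall t : R, is_derive t (1 : R) w (dw t),
    exists2 W : R, 0 <= W & forall t, `|t| <= c -> `|dw t| <= W,
    forall t, 0 <= w t <= 1, forall t, `|t| <= r -> w t = 0 &
    forall t, s <= `|t| -> 1 - w t <= d].
Proof.
move=> r0 rs d0.
(* This makes [K * P t] at least [d^-1] as soon as [t] has modulus at least [s]. *)
pose K := (d * (s ^+ 2 - r ^+ 2) ^+ 2)^-1.
have s0 : 0 < s by rewrite (lt_trans r0).
have sr : 0 < s ^+ 2 - r ^+ 2 by rewrite subr_gt0 ltrXn2r// ?nnegrE ltW.
have K0 : 0 < K by rewrite invr_gt0 mulr_gt0// exprn_gt0.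
pose P t : R := Num.max 0 (t ^+ 2 - r ^+ 2) ^+ 2.
pose dP t : R := 2 * Num.max 0 (t ^+ 2 - r ^+ 2) * (2 * t).
have P0 t : 0 <= P t by rewrite sqr_ge0.
have hP t : is_derive t (1 : R) P (dP t).
  have h1 : is_derive t (1 : R) (fun t => t ^+ 2 - r ^+ 2) (2 * t).
    apply: trigger_derive; rewrite /GRing.scale /= !mulr1; ring.
  exact: (is_derive1_comp (is_derive_posr_sqr _) h1).
have KP t : 0 < 1 + K * P t by rewrite ltr_wpDr// mulr_ge0// ltW.
have hV t : is_derive t (1 : R) (fun t => (1 + K * P t)^-1)
    (- (1 + K * P t) ^- 2 * (K * dP t)).
  apply: is_deriveV; first by rewrite gt_eqF.
  by apply: trigger_derive; rewrite /GRing.scale /=; ring.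
exists (fun t => 1 - (1 + K * P t)^-1).
exists (fun t => (1 + K * P t) ^- 2 * (K * dP t)); split.
- by move=> t; apply: trigger_derive; rewrite /GRing.scale /=; ring.
- exists (K * (2 * c ^+ 2 * (2 * `|c|))).
    by rewrite pmulr_rge0// mulr_ge0// pmulr_rge0// sqr_ge0.
  move=> t tc; rewrite normrM -[leRHS]mul1r ler_pM//.
    rewrite ger0_norm ?invr_ge0 ?exprn_ge0 ?(ltW (KP t))//.
    by rewrite invf_le1 ?exprn_gt0// exprn_ege1// lerDl mulr_ge0// ltW.
  rewrite normrM (gtr0_norm K0) ler_wpM2l ?(ltW K0)// /dP !normrM.
  have cc : `|c| = c by rewrite ger0_norm// (le_trans _ tc).
  rewrite cc ger0_norm// ler_pM//; last by rewrite ler_wpM2l.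
  rewrite ler_wpM2l// ger0_norm ?le_max ?lexx// ge_max sqr_ge0/=.
  rewrite lerBlDr ler_wpDr ?sqr_ge0// -real_normK ?num_real// lerXn2r// nnegrE.
  exact: le_trans tc.
- move=> t; rewrite subr_ge0 lerBlDr lerDl invr_ge0 (ltW (KP t)) andbT.
  by rewrite invf_le1// lerDl mulr_ge0// ltW.
- move=> t tr; rewrite /P max_l ?expr0n /= ?mulr0 ?addr0 ?invr1 ?subrr//.
  by rewrite subr_le0 -real_normK ?num_real// lerXn2r// nnegrE ltW.
- move=> t st; rewrite subKr -[leRHS]invrK lef_pV2 ?posrE ?invr_gt0//.
  have h1 : s ^+ 2 - r ^+ 2 <= Num.max 0 (t ^+ 2 - r ^+ 2).
    rewrite le_max lerD2r; apply/orP; right.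
    by rewrite -[leRHS]real_normK ?num_real// lerXn2r// nnegrE ltW.
  have h2 : (s ^+ 2 - r ^+ 2) ^+ 2 <= P t by rewrite lerXn2r// nnegrE ?ltW// (lt_le_trans sr).
  rewrite ler_wpDl// /K invfM mulrAC -mulrA ler_peMr ?invr_ge0 ?(ltW d0)//.
  by rewrite ler_pdivlMr ?exprn_gt0// mul1r.
Qed.

End Bump.

(** * Oscillating Legendrian approximation *)

Section Oscillation.
Context {R : realType}.

(** Coordinate labels that can be matched on; the translation to column numbers of row vectors is
    postponed to the end. *)
Definition idx (m : nat) : finType := ('I_m + 'I_m + unit)%type.
Definition ix {m} (j : 'I_m) : idx m := inl (inl j).
Definition iy {m} (j : 'I_m) : idx m := inl (inr j).
Definition iz {m} : idx m := inr tt.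

Definition pcontact {m} (F : idx m -> {poly R}) : {poly R} :=
  (F iz)^`() + \sum_(j < m) F (ix j) * (F (iy j))^`().

Lemma norm_sum8 (t1 t2 t3 t4 t5 t6 t7 t8 b1 b2 b3 b4 b5 b6 b7 b8 : R) :
  `|t1| <= b1 -> `|t2| <= b2 -> `|t3| <= b3 -> `|t4| <= b4 ->
  `|t5| <= b5 -> `|t6| <= b6 -> `|t7| <= b7 -> `|t8| <= b8 ->
  `|t1 + t2 + t3 + t4 - t5 - t6 + t7 + t8| <= b1 + b2 + b3 + b4 + b5 + b6 + b7 + b8.
Proof. rewrite !ler_norml; lra. Qed.

(* The terms of order [N] cancel against the derivative of the bounded
   primitive [E], and [- 2 g om^2 cs^2] averages to [- g om^2]. *)
Lemma oscillation_pointwise (g g' a a' b om om' sn cs e1 e2 N eta Gc G' X X' Y W p w dE : R) :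
  1 <= N -> eta <= N ^- 2 -> `|e1| <= eta -> `|e2| <= eta ->
  `|g| <= Gc -> `|g'| <= G' -> `|a| <= X -> `|a'| <= X' -> `|b| <= Y ->
  0 <= om <= 1 -> `|om'| <= W -> cs ^+ 2 + sn ^+ 2 = 1 -> `|sn| <= 1 -> `|cs| <= 1 ->
  p = - 2 * g * om * cs / N + e1 -> w = N * om * cs + e2 ->
  dE = (a' * om + a * om') * sn / N + a * om * N * cs
      - (g' * om ^+ 2 + 2 * g * om * om') * (sn * cs) / N ^+ 2
      - g * om ^+ 2 * (cs ^+ 2 - sn ^+ 2) ->
  `|g + a * w + p * b + p * w - dE| <= `|g| * (1 - om ^+ 2) +
    (X + (2 * Gc + 1) * Y + 2 + 2 * Gc + X' + X * W + G' + 2 * Gc * W) / N.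
Proof.
move=> N1 hN h1 h2 hg hg' ha ha' hb /andP[om0 om1] hW cs1 sn1 csl pE wE dEE.
have N0 : 0 < N by rewrite (lt_le_trans _ N1).
have Nn : N != 0 by rewrite gt_eqF.
have eta0 : 0 <= eta by rewrite (le_trans _ h1).
have i0 : 0 < N^-1 by rewrite invr_gt0.
have i1 : N^-1 <= 1 by rewrite invf_le1.
have iN : N ^- 2 <= N^-1.
  by rewrite expr2 invfM ler_piMl// ltW.
have eN : eta <= N^-1 by rewrite (le_trans hN).
have omn : `|om| <= 1 by rewrite ger0_norm.
have Gc0 := le_trans (normr_ge0 _) hg.
have pb : `|p| <= (2 * Gc + 1) / N.
  rewrite pE (le_trans (ler_normD _ _))// mulrDl mul1r lerD ?(le_trans h1)//.
  rewrite (_ : _ / N = 2 * (g * (om * cs)) / N * -1); last by ring.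
  rewrite !normrM normrN1 mulr1 normfV (gtr0_norm N0) normr_nat ler_pM2r// ler_wpM2l//.
  by rewrite -[leRHS]mulr1 ler_pM// mulr_ile1.
have wb : `|w| <= N + 1.
  rewrite wE (le_trans (ler_normD _ _))// lerD//; last by rewrite (le_trans h2)// (le_trans eN).
  by rewrite !normrM (gtr0_norm N0) -mulrA ler_piMr ?(ltW N0)// mulr_ile1.
have e1w : `|e1 * w| <= 2 / N.
  rewrite normrM (le_trans (ler_pM _ _ h1 wb))// (le_trans (ler_wpM2r _ hN)) ?addr_ge0 ?(ltW N0)//.
  rewrite ler_pdivlMr// [leLHS](_ : _ = 1 + N^-1); last by field.
  by rewrite -[X in _ <= X]/(1 + 1 : R) lerD2l.
have gN : `|- 2 * g * om * cs / N * e2| <= 2 * Gc / N.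
  rewrite (_ : - 2 * g * om * cs / N * e2 = 2 * (g * (om * cs * e2)) / N * -1); last by ring.
  rewrite !normrM normrN1 mulr1 normfV (gtr0_norm N0) normr_nat ler_pM2r// ler_wpM2l//.
  rewrite -[leRHS]mulr1 ler_pM// mulr_ile1// ?mulr_ge0// ?mulr_ile1//.
  by rewrite (le_trans h2)// (le_trans eN).
have -> : g + a * w + p * b + p * w - dE = g * (1 - om ^+ 2) + (a * e2 + p * b + e1 * w
   + (- 2 * g * om * cs / N) * e2 - a' * om * sn / N - a * om' * sn / N
   + g' * om ^+ 2 * (sn * cs) / N ^+ 2 + 2 * g * om * om' * (sn * cs) / N ^+ 2).
  (* The product [p * w] contributes [- 2 g om^2 cs^2], and [- dE] contributes
     [g om^2 (cs^2 - sn^2)]; their sum is [- g om^2 (cs^2 + sn^2)], so the identity for [cs] and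
     [sn] has to be inserted before the equality becomes rational. *)
  have -> : g * (1 - om ^+ 2) = g * (1 - om ^+ 2 * (cs ^+ 2 + sn ^+ 2)) by rewrite cs1 mulr1.
  rewrite dEE wE pE; field; exact: Nn.
rewrite (le_trans (ler_normD _ _))// lerD//.
  rewrite normrM ler_wpM2l// ger0_norm// subr_ge0 exprn_ile1//.
rewrite [leRHS](_ : _ = X / N + (2 * Gc + 1) * Y / N + 2 / N + 2 * Gc / N + X' / N + X * W / N
  + G' / N + 2 * Gc * W / N); last by rewrite !mulrDl.
have o2 : `|om ^+ 2 * (sn * cs)| <= 1.
  have om2 : `|om ^+ 2| <= 1 by rewrite normrX exprn_ile1.
  by rewrite normrM mulr_ile1// normrM mulr_ile1.
have i2 : `|N ^- 2| <= N^-1 by rewrite ger0_norm// invr_ge0 exprn_ge0// ltW.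
apply: norm_sum8.
- by rewrite normrM ler_pM// (le_trans h2).
- by rewrite normrM mulrAC ler_pM.
- exact: e1w.
- exact: gN.
- rewrite -!mulrA normrM ler_pM// normrM -[leRHS]mul1r ler_pM// normrM normfV (gtr0_norm N0) ler_piMl// ltW//.
- rewrite -!mulrA normrM ler_pM// normrM ler_pM// normrM normfV (gtr0_norm N0) ler_piMl// ltW//.
- rewrite -2!mulrA normrM ler_pM// mulrA normrM -[leRHS]mul1r ler_pM//.
- rewrite (_ : _ / _ = 2 * (g * (om' * ((om * (sn * cs)) * N ^- 2)))); last by ring.
  rewrite normrM normr_nat -!mulrA ler_wpM2l// normrM ler_pM// normrM ler_pM// normrM -[leRHS]mul1r ler_pM//.
  by rewrite mulrA normrM -[leRHS]mul1r ler_pM// normrM mulr_ile1.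
Qed.

Definition perturb {m} (j0 : 'I_m) (B : idx m -> {poly R}) (p q zeta : {poly R}) (i : idx m) :
  {poly R} := match i with
  | inl (inl j) => B i + (if j == j0 then p else 0)
  | inl (inr j) => B i + (if j == j0 then q else 0)
  | inr _ => B i - zeta
  end.

(** The changes [p] and [q] of one coordinate pair are free: taking for [zeta] a primitive of
    everything before it makes the curve Legendrian. *)
Lemma pcontact_perturb {m} (j0 : 'I_m) (B : idx m -> {poly R}) (p q zeta : {poly R}) :
  pcontact (perturb j0 B p q zeta) =
  pcontact B + (B (ix j0) * q^`() + p * (B (iy j0))^`() + p * q^`()) - zeta^`().
Proof.
rewrite /pcontact /= derivB -addrA [- _ + _]addrC !addrA; congr (_ - _).
rewrite -!addrA; congr (_ + _); rewrite (bigD1 j0)//= [in RHS](bigD1 j0)//= eqxx derivD.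
rewrite (eq_bigr (fun j => B (ix j) * (B (iy j))^`())); last first.
  by move=> j /negPf jj; rewrite /ix /iy jj !addr0.
by rewrite /ix /iy; ring.
Qed.

(** [N] is abstract because it is used both for the coefficient norm and for the absolute value at a
    point. *)
Lemma perturb_le {m} (j0 : 'I_m) (B : idx m -> {poly R}) (p q zeta : {poly R})
    (N : {poly R} -> R) (d : R) : N 0 <= d -> (forall u, N (- u) = N u) ->
  N p <= d -> N q <= d -> N zeta <= d ->
  forall i, N (perturb j0 B p q zeta i - B i) <= d.
Proof.
move=> N0 NN hp hq hz [[j|j]|?] /=; rewrite [_ - _]addrAC subrr add0r; try by case: eqP.
by rewrite NN.
Qed.

(** The term [c * dG] is the price of the region where the step is not yet close to 1: the defect is
    not corrected there, but it is at most [dG] on [-s, s], so its primitive is at most [c * dG].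
    Everything else is made smaller than [delta] by the choice of [N] and then of the polynomial
    error [eta]. *)
Lemma oscillation m (j0 : 'I_m) (B : idx m -> {poly R}) (r s c dG delta : R) :
  0 < r -> r < s -> s <= c -> pnorm s (pcontact B) <= dG -> 0 < delta ->
  exists F, [/\ pcontact F = 0, forall i, pnorm r (F i - B i) <= c * dG + delta &
    forall i t, `|t| <= c -> `|(F i - B i).[t]| <= c * dG + delta].
Proof.
move=> r0 rs sc hG delta0.
have s0 : 0 < s by rewrite (lt_trans r0).
have c0 : 0 < c by rewrite (lt_le_trans s0).
have dG0 : 0 <= dG by rewrite (le_trans (pnorm_ge0 _ (ltW s0)) hG).
set G := pcontact B in hG *.
set x1 := B (ix j0); set y1 := B (iy j0).
pose Gc := pnorm c G; pose G' := pnorm c G^`().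
pose X := pnorm c x1; pose X' := pnorm c x1^`(); pose Y := pnorm c y1^`().
have n0 p : 0 <= pnorm c p by rewrite pnorm_ge0// ltW.
have Gc0 : 0 <= Gc := n0 _.
have G'0 : 0 <= G' := n0 _.
have X0 : 0 <= X := n0 _.
have X'0 : 0 <= X' := n0 _.
have Y0 : 0 <= Y := n0 _.
(* Bound for the uncorrected defect outside [-s, s]; integrated over a length [c] it costs
   [delta / 4]. *)
pose d1 := delta / (4 * c).
have d10 : 0 < d1 by rewrite divr_gt0// mulr_gt0.
pose rho := (r + s) / 2.
have [rr rhos] : r < rho /\ rho < s by rewrite /rho; split; lra.
have rho0 : 0 < rho by rewrite (lt_trans r0).
(* With this tolerance for [1 - om], the factor [1 - om ^+ 2] is at most [d1 / (Gc + 1)], hence the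
   remaining defect at most [d1]. *)
have d20 : 0 < d1 / (2 * (Gc + 1)) by rewrite divr_gt0// mulr_gt0// ltr_wpDl ?n0.
have [om [dom [hom [W W0 hW] om01 om0 om1]]] := smooth_step c rho0 rhos d20.
have com := is_derive_continuous hom.
pose C := X + (2 * Gc + 1) * Y + 2 + 2 * Gc + X' + X * W + G' + 2 * Gc * W.
have C0 : 0 <= C by rewrite !addr_ge0 ?mulr_ge0 ?addr_ge0 ?mulr_ge0 ?n0.
(* [K1 / N] and [K2 / N] bound the displacements of [x] and [y]. [K3 / N] is four times the
   oscillating part of the displacement of [z], which leaves room for the share of [d1]. *)
pose K1 := 2 * Gc + 1.
pose K2 := c * (1 + W) + 1.
pose K3 := 4 * (c * C + X + Gc).
have K10 : 0 <= K1 by rewrite addr_ge0// mulr_ge0.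
have K20 : 0 <= K2 by rewrite addr_ge0// mulr_ge0 ?addr_ge0 ?(ltW c0).
have K30 : 0 <= K3 by rewrite mulr_ge0// !addr_ge0 ?n0// mulr_ge0 ?(ltW c0).
pose N := 1 + (K1 + K2 + K3) / delta.
have K0 : 0 <= K1 + K2 + K3 by apply: addr_ge0 K30; exact: addr_ge0.
have N1 : 1 <= N by rewrite /N lerDl divr_ge0 ?(ltW delta0).
have N0 : 0 < N by rewrite (lt_le_trans _ N1).
have KN K : K <= K1 + K2 + K3 -> K / N <= delta.
  move=> hK; rewrite ler_pdivrMr// mulrC -ler_pdivrMr//.
  by rewrite (le_trans (y := (K1 + K2 + K3) / delta)) ?ler_pM2r ?invr_gt0// lerDr.
have KN1 : K1 / N <= delta by apply: KN; lra.
have KN2 : K2 / N <= delta by apply: KN; lra.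
have KN3 : K3 / N <= delta by apply: KN; lra.
(* At radius [r] both [p] and [w] have norm at most [eta]; [Z * eta] bounds [p], the primitive of
   [w], and the part of the primitive of [Q] that involves [p] or [w]. *)
pose Z := r * (pnorm r x1 + pnorm r y1^`() + 1) + r + 1.
have n0r p : 0 <= pnorm r p by rewrite pnorm_ge0// ltW.
have Z1 : 1 <= Z by rewrite /Z lerDr addr_ge0 ?mulr_ge0 ?addr_ge0 ?n0r ?(ltW r0).
have Z0 : 0 < Z by rewrite (lt_le_trans _ Z1).
pose eta := Num.min (N ^- 2) (delta / Z).
have eta0 : 0 < eta by rewrite lt_min invr_gt0 exprn_gt0//= divr_gt0.
have etaN : eta <= N ^- 2 by rewrite ge_min lexx.
have iN : N ^- 2 <= N^-1 by rewrite expr2 invfM ler_piMl ?invr_ge0 ?(ltW N0)// invf_le1.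
have iN1 : N^-1 <= 1 by rewrite invf_le1.
have eta1 : eta <= 1 by rewrite (le_trans etaN)// (le_trans iN).
have etaZ : Z * eta <= delta by rewrite mulrC -ler_pdivlMr// ge_min lexx orbT.
pose sn t := sin (N ^+ 2 * t); pose cs t := cos (N ^+ 2 * t).
have dlin t : is_derive t (1 : R) (fun t : R => N ^+ 2 * t) (N ^+ 2).
  by apply: trigger_derive; rewrite /GRing.scale /=; ring.
have dsn t : is_derive t (1 : R) sn (cs t * N ^+ 2) by exact: is_derive1_comp.
have dcs t : is_derive t (1 : R) cs (- sn t * N ^+ 2) by exact: is_derive1_comp.
have csc := is_derive_continuous dcs.
have sn1 t : `|sn t| <= 1 by exact: sin_max.
have cs1 t : `|cs t| <= 1 by exact: cos_max.
have cs2 t : cs t ^+ 2 + sn t ^+ 2 = 1 by exact: cos2Dsin2.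
pose h1 t := - 2 * G.[t] * om t * cs t / N.
pose h2 t := N * om t * cs t.
have ch1 : continuous h1.
  move=> t; apply: cvgM; last exact: cvg_cst.
  apply: cvgM; last exact: csc.
  by apply: cvgM; [apply: cvgM; [exact: cvg_cst|exact: continuous_horner]|exact: com].
have ch2 : continuous h2.
  move=> t; apply: cvgM; last exact: csc.
  by apply: cvgM; [exact: cvg_cst|exact: com].
have h10 t : `|t| <= rho -> h1 t = 0 by move=> ht; rewrite /h1 om0// mulr0 !mul0r.
have h20 t : `|t| <= rho -> h2 t = 0 by move=> ht; rewrite /h2 om0// mulr0 !mul0r.
have rhoc : rho <= c by rewrite (le_trans (ltW rhos)).
have [p pr hp] := approx_vanishing ch1 r0 rr rhoc eta0 h10.
have [w wr hw] := approx_vanishing ch2 r0 rr rhoc eta0 h20.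
pose Q := G + x1 * w + p * y1^`() + p * w.
exists (perturb j0 B p (prim w) (prim Q)); split.
- by rewrite pcontact_perturb !deriv_prim -/G -/x1 -/y1 /Q; ring.
- have cdG : 0 <= c * dG by rewrite mulr_ge0// ltW.
  have r0' := ltW r0.
  have le1 : eta <= delta by rewrite (le_trans _ etaZ)// ler_peMl// ltW.
  have le2 : r * eta <= delta.
    rewrite (le_trans _ etaZ)// ler_wpM2r ?(ltW eta0)// /Z.
    by have := n0r x1; have := n0r y1^`(); nra.
  apply: perturb_le => [|u|||].
  + by rewrite pnorm0 addr_ge0// ltW.
  + exact: pnormN.
  + by rewrite (le_trans pr)// ler_wpDl.
  + rewrite (le_trans (pnorm_prim _ r0'))// ler_wpDl// (le_trans _ le2)//.
    by rewrite ler_wpM2l.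
  + rewrite (le_trans (pnorm_prim _ r0'))//.
    have hQ : pnorm r Q <= dG + (pnorm r x1 + pnorm r y1^`() + 1) * eta.
      rewrite /Q (le_trans (pnormD _ _ r0'))// (_ : dG + _ = dG + pnorm r x1 * eta
        + eta * pnorm r y1^`() + eta * 1); last by ring.
      apply: lerD; last first.
        by rewrite (le_trans (pnormM _ _ r0'))// ler_pM ?n0r// (le_trans wr).
      rewrite (le_trans (pnormD _ _ r0'))// lerD//; last first.
        by rewrite (le_trans (pnormM _ _ r0'))// ler_pM ?n0r.
      rewrite (le_trans (pnormD _ _ r0'))// lerD//; last first.
        by rewrite (le_trans (pnormM _ _ r0'))// ler_pM ?n0r.
      by rewrite (le_trans (pnorm_le _ r0' (ltW rs))).
    rewrite (le_trans (ler_wpM2l r0' hQ))// mulrDr lerD//.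
      by rewrite ler_wpM2r// (le_trans (ltW rs)).
    rewrite mulrA (le_trans _ etaZ)// ler_wpM2r ?(ltW eta0)// /Z -[leRHS]addrA lerDl.
    by rewrite addr_ge0.
- move=> i t tc; move: i.
  have cdG : 0 <= c * dG by rewrite mulr_ge0// ltW.
  have p_bound u : `|u| <= c -> `|p.[u] - h1 u| <= eta := hp u.
  have h1b u : `|u| <= c -> `|h1 u| <= 2 * Gc / N.
    move=> uc; rewrite /h1 (_ : _ / N = 2 * (G.[u] * (om u * cs u)) / N * -1); last by ring.
    rewrite !normrM normrN1 mulr1 normfV (gtr0_norm N0) normr_nat ler_pM2r ?invr_gt0// ler_wpM2l//.
    have /andP[v0 v1] := om01 u.
    rewrite -[leRHS]mulr1 ler_pM ?mulr_ge0 ?horner_pnorm//.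
    by rewrite mulr_ile1// ger0_norm.
  apply: (@perturb_le _ _ _ _ _ _ (fun u : {poly R} => `|u.[t]|)) => [|u|||].
  + by rewrite horner0 normr0 addr_ge0// ltW.
  + by rewrite hornerN normrN.
  + rewrite ler_wpDl// (le_trans _ KN1)// -[p.[t]](subrK (h1 t)) (le_trans (ler_normD _ _))//.
    by rewrite addrC /K1 mulrDl mul1r lerD ?h1b// (le_trans (hp _ tc))// (le_trans etaN).
  + rewrite ler_wpDl// (le_trans _ KN2)//.
    (* The leading part of [w] is [N om cs], whose primitive is [om sn / N] up to the term with the
       derivative of the step. Since [D] vanishes at 0, a derivative of order [1 / N] suffices. *)
    pose D u := (prim w).[u] - om u * sn u / N.
    have hD u : is_derive u (1 : R) D ((w.[u] - h2 u) - dom u * sn u / N).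
      have := is_derive_poly (prim w) u; rewrite deriv_prim => hw'.
      rewrite /D; apply: trigger_derive; rewrite /h2 /GRing.scale /=; field; exact: lt0r_neq0.
    have bD u : `|u| <= c -> `|(w.[u] - h2 u) - dom u * sn u / N| <= (1 + W) / N.
      move=> uc; rewrite (le_trans (ler_normB _ _))// mulrDl mul1r lerD//.
        by rewrite (le_trans (hw _ uc))// (le_trans etaN).
      rewrite !normrM normfV (gtr0_norm N0) ler_pM2r ?invr_gt0//.
      by rewrite -[leRHS]mulr1 ler_pM// hW.
    have := mvt_bound hD bD tc.
    have -> : D 0 = 0.
      by rewrite /D prim0 /sn mulr0 sin0 mulr0 mul0r subr0.
    rewrite subr0 => h.
    have -> : (prim w).[t] = D t + om t * sn t / N by rewrite /D subrK.
    rewrite (le_trans (ler_normD _ _))// /K2 mulrDl mul1r lerD//.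
      rewrite (le_trans h)// mulrC mulrA ler_pM2r ?invr_gt0// ler_wpM2r ?addr_ge0//.
    have /andP[v0 v1] := om01 t.
    rewrite !normrM normfV (gtr0_norm N0) ler_piMl ?invr_ge0 ?(ltW N0)//.
    by rewrite mulr_ile1// ger0_norm.
  (* The first term integrates the part of order [N] of [x1 * w]; the second integrates the
     oscillating part of [- 2 G om^2 cs^2], that is, its deviation from the average [- G om^2]. *)
  + pose E u := x1.[u] * om u * sn u / N - G.[u] * om u ^+ 2 * (sn u * cs u) / N ^+ 2.
    pose dE u := (x1^`().[u] * om u + x1.[u] * dom u) * sn u / N + x1.[u] * om u * N * cs u
      - (G^`().[u] * om u ^+ 2 + 2 * G.[u] * om u * dom u) * (sn u * cs u) / N ^+ 2
      - G.[u] * om u ^+ 2 * (cs u ^+ 2 - sn u ^+ 2).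
    pose D u := (prim Q).[u] - E u.
    have hD u : is_derive u (1 : R) D (Q.[u] - dE u).
      have := is_derive_poly (prim Q) u; rewrite deriv_prim => hQ'.
      rewrite /D /E; apply: trigger_derive; rewrite /dE /GRing.scale /=; field; exact: lt0r_neq0.
    have bD u : `|u| <= c -> `|Q.[u] - dE u| <= dG + d1 + C / N.
      move=> uc.
      have -> : Q.[u] = G.[u] + x1.[u] * w.[u] + p.[u] * y1^`().[u] + p.[u] * w.[u].
        by rewrite /Q !(hornerD, hornerM).
      apply: le_trans (oscillation_pointwise (e1 := p.[u] - h1 u) (e2 := w.[u] - h2 u)
        (om := om u) (om' := dom u) (g' := G^`().[u]) (a' := x1^`().[u]) (sn := sn u) (cs := cs u)
        (Gc := Gc) (G' := G') (X := X) (X' := X') (Y := Y) (W := W) N1 etaN (hp _ uc) (hw _ uc)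
        _ _ _ _ _ (om01 u) (hW _ uc) (cs2 u) (sn1 u) (cs1 u) _ _ _) _.
      1-5: exact: horner_pnorm.
      * by rewrite /h1; ring.
      * by rewrite /h2; ring.
      * by [].
      rewrite lerD2r; have /andP[v0 v1] := om01 u.
      have oo : 0 <= 1 - om u ^+ 2 <= 1.
        by rewrite subr_ge0 exprn_ile1//= lerBlDr lerDl sqr_ge0.
      (* Inside [-s, s] the defect itself is small; outside, the factor [1 - om ^+ 2] is. *)
      have [us|us] := leP `|u| s.
        apply: (@le_trans _ _ dG); last by rewrite lerDl ltW.
        rewrite (le_trans (ler_piMr _ (proj2 (andP oo))))//.
        by rewrite (le_trans (horner_pnorm _ us)).
      rewrite ler_wpDl//.
      have h3 : 1 - om u ^+ 2 <= 2 * (d1 / (2 * (Gc + 1))).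
        by have := om1 u (ltW us); nra.
      apply: (@le_trans _ _ (Gc * (d1 / (Gc + 1)))).
        rewrite ler_pM ?horner_pnorm//; first by case/andP: oo.
        apply: (le_trans h3); rewrite le_eqVlt; apply/orP; left; apply/eqP.
        by field; rewrite gt_eqF// ltr_wpDl.
      rewrite mulrA ler_pdivrMr ?ltr_wpDl// mulrC ler_wpM2l ?(ltW d10)// lerDl//.
    have := mvt_bound hD bD tc.
    have E0 : D 0 = 0.
      by rewrite /D /E prim0 /sn mulr0 sin0 !(mulr0, mul0r) !subr0.
    rewrite E0 subr0 => h.
    have Eb : `|E t| <= (X + Gc) / N.
      have /andP[v0 v1] := om01 t.
      rewrite /E (le_trans (ler_normB _ _))// mulrDl lerD//.
        rewrite -mulrA -mulrA normrM ler_pM ?horner_pnorm// mulrA normrM normfV (gtr0_norm N0).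
        by rewrite ler_piMl ?invr_ge0 ?(ltW N0)// normrM mulr_ile1// ger0_norm.
      rewrite -mulrA -mulrA normrM ler_pM ?horner_pnorm// mulrA normrM.
      rewrite -[leRHS]mul1r ler_pM//; last by rewrite ger0_norm ?invr_ge0 ?exprn_ge0 ?(ltW N0).
      rewrite normrM mulr_ile1//; last by rewrite normrM mulr_ile1.
      by rewrite normrX ger0_norm// exprn_ile1.
    have -> : (prim Q).[t] = D t + E t by rewrite /D subrK.
    rewrite (le_trans (ler_normD _ _))// (le_trans (lerD h Eb))//.
    have b0 : 0 <= dG + d1 + C / N by rewrite !addr_ge0 ?(ltW d10)// divr_ge0// ltW.
    apply: (le_trans (lerD (ler_wpM2l b0 tc) (lexx _))).
    have -> : (dG + d1 + C / N) * c + (X + Gc) / N = c * dG + (d1 * c + (c * C + X + Gc) / N) by ring.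
    rewrite lerD2l.
    have -> : d1 * c = delta / 4 by rewrite /d1; field; rewrite gt_eqF.
    have -> : (c * C + X + Gc) / N = (K3 / N) / 4 by rewrite /K3; field; exact: lt0r_neq0.
    by move: KN3; lra.
Qed.

End Oscillation.

(** * One approximation step to a larger interval *)

Section Step.
Context {R : realType}.

Lemma fin_lower_bound (I : finType) (d : I -> R) : (forall i, 0 < d i) ->
  exists2 d0, 0 < d0 & forall i, d0 <= d i.
Proof.
move=> h; exists (\big[Order.min/1]_i d i); last by move=> i; exact: bigmin_le.
by elim/big_ind : _ => // x y x0 y0; rewrite lt_min x0.
Qed.

Lemma fin_upper_bound (I : finType) (d : I -> R) : exists2 M, 0 <= M & forall i, d i <= M.
Proof.
exists (\sum_i `|d i|); first exact: sumr_ge0.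
move=> i; rewrite (bigD1 i)//= (le_trans (ler_norm _))// lerDl; exact: sumr_ge0.
Qed.

Lemma segment_pos_lb (c : R) (g : R -> R) : continuous g -> (forall t, `|t| <= c -> 0 < g t) ->
  exists2 d, 0 < d & forall t, `|t| <= c -> d <= g t.
Proof.
move=> cg g0; have [c0|c0] := leP 0 c; last first.
  by exists 1 => // t tc; have := le_trans (normr_ge0 t) tc; rewrite leNgt c0.
have [m mc hm] := EVT_min (a := - c) (b := c) ltac:(by rewrite ge0_cp) (continuous_subspaceT cg).
exists (g m); first by apply: g0; move: mc; rewrite in_itv /= -ler_norml.
by move=> t tc; apply: hm; rewrite in_itv /= -ler_norml.
Qed.

Lemma margin (I : finType) (F : I -> {poly R}) (f0 : I -> R -> R) (e : R -> R) (s : R) :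
  (forall i, continuous (f0 i)) -> continuous e ->
  (forall i t, `|t| <= s -> `|(F i).[t] - f0 i t| < e t) ->
  exists2 d, 0 < d & forall i t, `|t| <= s -> `|(F i).[t] - f0 i t| <= e t - d.
Proof.
move=> cf ce h.
have /choice[d hd] i : exists d, 0 < d /\ forall t, `|t| <= s -> `|(F i).[t] - f0 i t| <= e t - d.
  have [||d d0 hd] := @segment_pos_lb s (fun t => e t - `|(F i).[t] - f0 i t|).
  - move=> t; apply: cvgB; first exact: ce.
    by apply: cvg_norm; apply: cvgB; [exact: continuous_horner|exact: cf].
  - by move=> t ts; rewrite subr_gt0 h.
  - by exists d; split=> // t ts; rewrite lerBrDr addrC -lerBrDr hd.
have [d0 d00 hd0] := fin_lower_bound (fun i => proj1 (hd i)).
exists d0 => // i t ts; rewrite (le_trans (proj2 (hd i) t ts))// lerD2l lerN2//.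
Qed.

(** The order of quantifiers matters: the margin [tau] is fixed before the closeness [d] to [F]. The
    later choice of [d] depends on [tau], because the correction of the contact defect has to fit
    into that margin. *)
Lemma fine_approximation m (F : idx m -> {poly R}) (f0 : idx m -> R -> R) (e : R -> R) (r s c : R) :
  (forall i, continuous (f0 i)) -> continuous e -> (forall t, 0 < e t) ->
  0 < r -> r < s -> s <= c ->
  (forall i t, `|t| <= s -> `|(F i).[t] - f0 i t| < e t) ->
  exists2 tau, 0 < tau & forall d, 0 < d -> exists B : idx m -> {poly R},
    (forall i, pnorm r (B i - F i) <= d) /\
    forall i t, `|t| <= c -> `|(B i).[t] - f0 i t| <= e t - tau.
Proof.
move=> cf ce e_gt0 r0 rs sc hF.
have c0 : 0 < c by rewrite (lt_le_trans _ sc)// (lt_trans r0).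
have [e0 e00 he0] := segment_pos_lb ce (fun t (_ : `|t| <= c) => e_gt0 t).
have [t1 t10 ht1] := margin cf ce hF.
have e40 : 0 < e0 / 4 by rewrite divr_gt0.
have /choice[q hq] i := weierstrass (cf i) c0 e40.
have [M M0 hM] := fin_upper_bound (fun i => pnorm c (q i - F i)).
have M10 : 0 < M + 1 by rewrite ltr_wpDl.
pose tau := Num.min t1 (e0 / 4).
have tau1 : tau <= t1 by rewrite ge_min lexx.
have tau2 : tau <= e0 / 4 by rewrite ge_min lexx orbT.
exists tau; first by rewrite lt_min t10.
move=> d d0.
pose d1 := Num.min (d / (M + 1)) (e0 / 4 / (M + 1)).
have d10 : 0 < d1 by rewrite lt_min !divr_gt0.
have d1d : d1 * M <= d.
  apply: (@le_trans _ _ (d1 * (M + 1))); first by rewrite ler_wpM2l ?(ltW d10)// lerDl.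
  by rewrite -ler_pdivlMr// ge_min lexx.
have d1e : d1 * M <= e0 / 4.
  apply: (@le_trans _ _ (d1 * (M + 1))); first by rewrite ler_wpM2l ?(ltW d10)// lerDl.
  by rewrite -ler_pdivlMr// ge_min lexx orbT.
have [chi [chi1 chi01 chi2]] := threshold r0 rs sc d10.
have r0' := ltW r0.
(* On [-s, s] this is a convex combination of two admissible approximations; beyond, [chi] is so
   close to 1 that the Weierstrass polynomial [q] decides. *)
exists (fun i => F i + chi * (q i - F i)); split=> [i|i t tc].
  rewrite addrAC subrr add0r (le_trans (pnormM _ _ r0'))//.
  rewrite (le_trans _ d1d)// ler_pM ?pnorm_ge0//.
  by rewrite (le_trans _ (hM i))// pnorm_le// (le_trans (ltW rs)).
have /andP[x0 x1] := chi01 t tc.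
have et := he0 t tc; have qt := hq i t tc.
rewrite hornerD hornerM hornerD hornerN.
have [ts|ts] := leP `|t| s.
  have Ft := ht1 i t ts.
  move: x0 x1 et qt Ft; set x := chi.[t]; set a := (q i).[t]; set b := (F i).[t].
  set f := f0 i t => x0 x1 et qt Ft.
  have -> : b + x * (a - b) - f = (1 - x) * (b - f) + x * (a - f) by ring.
  have y0 : 0 <= 1 - x by rewrite subr_ge0.
  rewrite (le_trans (ler_normD _ _))// !normrM (ger0_norm x0) (ger0_norm y0).
  by have := ler_wpM2l x0 qt; have := ler_wpM2l y0 Ft; nra.
have ht : `|((q i - F i)).[t]| <= M by rewrite (le_trans (horner_pnorm _ tc)).
move: ht; rewrite hornerD hornerN => ht.
have y0 : 0 <= 1 - chi.[t] by rewrite subr_ge0.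
have -> : (F i).[t] + chi.[t] * ((q i).[t] - (F i).[t]) - f0 i t =
  ((q i).[t] - f0 i t) - (1 - chi.[t]) * ((q i).[t] - (F i).[t]) by ring.
rewrite (le_trans (ler_normB _ _))// normrM (ger0_norm y0).
have := ler_pM y0 (normr_ge0 _) (chi2 t (ltW ts) tc) ht.
by move: qt et d1e tau2; lra.
Qed.

(** As [F] has no defect, the defect of [B] is a difference, each term of which contains a factor
    [B i - F i] or its derivative. The bound [d <= 1] keeps the other factor bounded, so the
    estimate is linear in [d]. *)
Lemma pcontact_close m (F : idx m -> {poly R}) (r s : R) :
  0 < r -> r < s -> pcontact F = 0 ->
  exists2 C, 0 < C & forall d (B : idx m -> {poly R}), 0 <= d -> d <= 1 ->
    (forall i, pnorm s (B i - F i) <= d) -> pnorm r (pcontact B) <= C * d.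
Proof.
move=> r0 rs F0; have s0 : 0 < s by rewrite (lt_trans r0).
have [M M0 hM] := fin_upper_bound (fun i => pnorm s (F i)).
pose h := s - r; have h0 : 0 < h by rewrite subr_gt0.
have hder p : pnorm r p^`() <= pnorm s p / h.
  by rewrite (le_trans (pnorm_deriv p (ltW r0) h0))// /h subrKC.
have hle p : pnorm r p <= pnorm s p by rewrite pnorm_le// ltW.
have n0 p : 0 <= pnorm r p by rewrite pnorm_ge0// ltW.
exists ((1 + m%:R * (2 * M + 1)) / h).
  by rewrite divr_gt0// ltr_pwDl// mulr_ge0// addr_ge0// mulr_ge0.
move=> d B d0 d1 hB.
have -> : pcontact B = (B iz - F iz)^`() +
    \sum_(j < m) ((B (ix j) - F (ix j)) * (B (iy j))^`() + F (ix j) * (B (iy j) - F (iy j))^`()).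
  have -> : pcontact B = pcontact B - pcontact F by rewrite F0 subr0.
  rewrite /pcontact derivB opprD addrACA; congr (_ + _).
  by rewrite -sumrB; apply: eq_bigr => j _; rewrite derivB; ring.
rewrite (le_trans (pnormD _ _ (ltW r0)))//.
rewrite (_ : _ / h * d = d / h + m%:R * ((2 * M + 1) * d / h)); last by ring.
rewrite lerD//; first by rewrite (le_trans (hder _))// ler_pM2r ?invr_gt0.
rewrite (le_trans (pnorm_sum _ _ _ (ltW r0)))// mulr_natl -[X in _ <= _ *+ X]card_ord -sumr_const.
apply: ler_sum => j _; rewrite (le_trans (pnormD _ _ (ltW r0)))//.
rewrite (_ : (2 * M + 1) * d / h = d * ((M + 1) / h) + M * (d / h)); last by ring.
rewrite lerD// (le_trans (pnormM _ _ (ltW r0)))// ler_pM//.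
- exact: le_trans (hle _) (hB _).
- rewrite (le_trans (hder _))// ler_pM2r ?invr_gt0//.
  rewrite -[B (iy j)](subrK (F (iy j))) (le_trans (pnormD _ _ (ltW s0)))// addrC lerD//.
  exact: le_trans (hB _) d1.
- exact: le_trans (hle _) (hM _).
- by rewrite (le_trans (hder _))// ler_pM2r ?invr_gt0.
Qed.

Lemma legendrian_step m (j0 : 'I_m) (F : idx m -> {poly R}) (f0 : idx m -> R -> R) (e : R -> R)
    (r s c d : R) :
  (forall i, continuous (f0 i)) -> continuous e -> (forall t, 0 < e t) ->
  0 < r -> r < s -> s <= c -> 0 < d -> pcontact F = 0 ->
  (forall i t, `|t| <= s -> `|(F i).[t] - f0 i t| < e t) ->
  exists F' : idx m -> {poly R}, [/\ pcontact F' = 0, forall i, pnorm r (F' i - F i) <= d &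
    forall i t, `|t| <= c -> `|(F' i).[t] - f0 i t| < e t].
Proof.
move=> cf ce e0 r0 rs sc d0 F0 hF.
(* [B] is close to [F] at radius [r2]; its defect, which involves a derivative, is controlled at
   [r1]; the oscillation then keeps control at [r]. *)
pose r1 := r + (s - r) / 3; pose r2 := r + 2 * (s - r) / 3.
have [rr1 r12 r2s] : [/\ r < r1, r1 < r2 & r2 < s] by rewrite /r1 /r2; split; lra.
have r10 : 0 < r1 by rewrite (lt_trans r0).
have r20 : 0 < r2 by rewrite (lt_trans r10).
have c0 : 0 < c by rewrite (lt_le_trans _ sc)// (lt_trans r20).
have r1c : r1 <= c by rewrite (le_trans _ sc)// ltW// (lt_trans r12).
have [tau tau0 htau] := fine_approximation cf ce e0 r20 r2s sc hF.
have [C C0 hC] := pcontact_close r10 r12 F0.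
pose d1 := Num.min tau d / 4.
have d10 : 0 < d1 by rewrite divr_gt0// lt_min tau0.
have [d1t d1d] : d1 <= tau / 4 /\ d1 <= d / 4.
  by split; rewrite ler_pM2r ?invr_gt0// ge_min lexx ?orbT.
(* The last entry makes the defect at most [d1 / c], so that the oscillation moves the curve by at
   most [2 * d1], which is below [tau] and at most [d / 2]. *)
pose dB := Num.min (Num.min (d / 2) 1) (d1 / c / C).
have dB0 : 0 < dB.
  by rewrite /dB !lt_min ltr01 andbT; apply/andP; split; [|apply: divr_gt0 => //]; apply: divr_gt0.
have [B [B1 B2]] := htau dB dB0.
have hG : pnorm r1 (pcontact B) <= d1 / c.
  rewrite (le_trans (hC dB B (ltW dB0) _ B1))//; first by rewrite !ge_min lexx orbT.
  by rewrite mulrC -ler_pdivlMr// !ge_min lexx orbT.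
have [F' [F'0 F'1 F'2]] := oscillation j0 r0 rr1 r1c hG d10.
have E : c * (d1 / c) + d1 = 2 * d1 by field; rewrite gt_eqF.
exists F'; split=> // [i|i t tc].
  rewrite -[F' i](subrK (B i)) -addrA (le_trans (pnormD _ _ (ltW r0)))//.
  have h1 : pnorm r (B i - F i) <= d / 2.
    have rr2 : r <= r2 by rewrite ltW// (lt_trans rr1).
    rewrite (le_trans (pnorm_le _ (ltW r0) rr2))// (le_trans (B1 i))// /dB.
    by rewrite !ge_min lexx.
  by have := F'1 i; rewrite E; lra.
have h1 := B2 i t tc; have := F'2 i t tc; rewrite E hornerD hornerN => h2.
rewrite -[(F' i).[t]](subrK (B i).[t]) -addrA (le_lt_trans (ler_normD _ _))//.
by move: tau0; lra.
Qed.

End Step.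

(** * Stability and genericity of injective immersions *)

Section Stability.
Context {R : realType}.

(** If both functions agree at [s] and [t], Rolle's theorem gives nearby zeros of both derivatives.
    Uniform continuity costs [d / 4] and C^1 closeness [d / 8] for each of the two functions, in
    total less than the lower bound [d] of the speed at [s]. *)
Lemma near_injective (x y : {poly R}) (k : R) :
  (forall t, `|t| <= k -> 0 < `|x^`().[t]| + `|y^`().[t]|) ->
  exists eta m : R, [/\ 0 < eta, 0 < m & forall g h dg dh : R -> R,
    (forall t : R, is_derive t (1 : R) g (dg t)) -> (forall t : R, is_derive t (1 : R) h (dh t)) ->
    (forall t, `|t| <= k -> `|dg t - x^`().[t]| <= m) ->
    (forall t, `|t| <= k -> `|dh t - y^`().[t]| <= m) ->
    (forall t, `|t| <= k -> 0 < `|dg t| + `|dh t|) /\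
    forall s t, `|s| <= k -> `|t| <= k -> s < t -> t - s < eta -> g s = g t -> h s = h t -> False].
Proof.
move=> hxy.
have cp (p : {poly R}) : continuous (fun t => `|p.[t]|).
  by move=> t; apply: cvg_norm; exact: continuous_horner.
have [|d d0 hd] := @segment_pos_lb R k (fun t => `|x^`().[t]| + `|y^`().[t]|) _ hxy.
  by move=> t; apply: cvgD; exact: cp.
have d40 : 0 < d / 4 by rewrite divr_gt0.
have [e1 e10 he1] := segment_unif_cont k (@continuous_horner R x^`()) d40.
have [e2 e20 he2] := segment_unif_cont k (@continuous_horner R y^`()) d40.
exists (Num.min e1 e2), (d / 8); split; [by rewrite lt_min e10|by rewrite divr_gt0|].
move=> g h dg dh hg hh dgx dhy; split.
  move=> t tk; have := hd t tk; have := dgx t tk; have := dhy t tk.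
  have := ler_normB (dg t) (dg t - x^`().[t]); rewrite subKr.
  have := ler_normB (dh t) (dh t - y^`().[t]); rewrite subKr.
  by lra.
move=> s t sk tk st; rewrite lt_min => /andP[st1 st2] gst hst.
have ink u : u \in `]s, t[%R -> `|u| <= k /\ `|s - u| < t - s.
  rewrite in_itv /= => /andP[su ut]; move: sk tk; rewrite !ler_norml => /andP[? ?] /andP[? ?].
  by split; [apply/andP; split; lra|rewrite ltr_norml; apply/andP; split; lra].
have rolle (f df : R -> R) : (forall t : R, is_derive t (1 : R) f (df t)) -> f s = f t ->
    exists2 u, u \in `]s, t[%R & df u = 0.
  move=> hf fst; have [||u hu hu'] := @Rolle R f s t st _ _ fst.
  - by move=> u _; exact: (@ex_derive _ _ _ _ _ _ _ (hf u)).
  - exact: continuous_subspaceT (is_derive_continuous hf).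
  - by exists u => //; have := hf u => /@derive_val <-; exact: derive_val.
have [u hu dgu] := rolle _ _ hg gst.
have [v hv dhv] := rolle _ _ hh hst.
have [uk su] := ink u hu; have [vk sv] := ink v hv.
have := he1 s u sk uk (lt_trans su st1); have := he2 s v sk vk (lt_trans sv st2).
have := dgx u uk; have := dhy v vk; rewrite dgu dhv !sub0r !normrN.
have := ler_normD (x^`().[s] - x^`().[u]) x^`().[u].
have := ler_normD (y^`().[s] - y^`().[v]) y^`().[v]; rewrite !subrK.
by have := hd s sk; lra.
Qed.

(** Pairs with [t - s < eta] are settled by [near_injective]. The others form a compact set, on
    which the total separation is at least some [d2]; each of the [n] coordinates loses at most
    [2 * d] of it. *)
Lemma stability m (j0 : 'I_m) (F : idx m -> {poly R}) (k : R) :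
  (forall t, `|t| <= k -> 0 < `|(F (ix j0))^`().[t]| + `|(F (iy j0))^`().[t]|) ->
  (forall s t, `|s| <= k -> `|t| <= k -> s < t -> exists i, (F i).[s] != (F i).[t]) ->
  exists2 d, 0 < d & forall (g dg : idx m -> R -> R),
    (forall i (t : R), is_derive t (1 : R) (g i) (dg i t)) ->
    (forall i t, `|t| <= k -> `|g i t - (F i).[t]| <= d) ->
    (forall i t, `|t| <= k -> `|dg i t - (F i)^`().[t]| <= d) ->
    (forall t, `|t| <= k -> 0 < `|dg (ix j0) t| + `|dg (iy j0) t|) /\
    forall s t, `|s| <= k -> `|t| <= k -> s < t -> exists i, g i s != g i t.
Proof.
move=> himm hinj.
have [eta [d1 [eta0 d10 hnear]]] := near_injective himm.
pose f (p : R * R) := \sum_(i : idx m) `|(F i).[p.1] - (F i).[p.2]|.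
have cf : continuous f.
  move=> p; apply: cvg_big; first exact: add_continuous.
  move=> i _; apply: cvg_norm; apply: cvgB.
    by apply: continuous_comp; [exact: cvg_fst|exact: continuous_horner].
  by apply: continuous_comp; [exact: cvg_snd|exact: continuous_horner].
have cg : continuous (fun p : R * R => p.2 - p.1 - eta).
  by move=> p; apply: cvgB; [apply: cvgB; [exact: cvg_snd|exact: cvg_fst]|exact: cvg_cst].
have [|d2 d20 hd2] := @square_lower_bound R k f _ cf cg.
  move=> s t sk tk /=; rewrite subr_ge0 => st.
  have [|i hi] := hinj s t sk tk; first by rewrite -subr_gt0 (lt_le_trans _ st).
  rewrite /f (bigD1 i)//= ltr_pwDl ?normr_gt0 ?subr_eq0//; exact: sumr_ge0.
pose n : R := #|{: idx m}|%:R.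
have n0 : 0 <= n by rewrite ler0n.
pose d := Num.min d1 (d2 / (2 * n + 1)).
have dn : 0 < 2 * n + 1 by rewrite ltr_wpDl// mulr_ge0.
have d0 : 0 < d by rewrite /d lt_min d10 divr_gt0.
have dd1 : d <= d1 by rewrite ge_min lexx.
have dd2 : 2 * n * d < d2.
  have : d * (2 * n + 1) <= d2 by rewrite -ler_pdivlMr// ge_min lexx orbT.
  by move: d0; lra.
exists d => // g dg hg hd hdd.
have [||h1 h2] := hnear _ _ _ _ (hg (ix j0)) (hg (iy j0)).
- by move=> t tk; rewrite (le_trans (hdd _ _ tk)).
- by move=> t tk; rewrite (le_trans (hdd _ _ tk)).
split=> // s t sk tk st; apply: contrapT => hn.
have gst i : g i s = g i t.
  by apply: contrapT => /eqP h; apply: hn; exists i.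
have [ts|ts] := ltP (t - s) eta; first exact: (h2 s t).
have := hd2 s t sk tk; rewrite /= subr_ge0 => /(_ ts); apply/negP; rewrite -ltNge.
apply: le_lt_trans dd2; rewrite /f /= -mulrA mulrCA mulr_natl -sumr_const.
apply: ler_sum => i _.
rewrite (_ : _ - _ = (g i t - (F i).[t]) - (g i s - (F i).[s])); last by rewrite gst; ring.
by rewrite (le_trans (ler_normB _ _))// mulr_natl mulr2n lerD ?hd.
Qed.

End Stability.

(** * Zeros of polynomials and Lipschitz images of planar sets *)

Section Generic.
Context {R : realType}.

Lemma poly_eq0_segment (p : {poly R}) (s t : R) : s < t ->
  (forall u, s <= u -> u <= t -> p.[u] = 0) -> p = 0.
Proof.
move=> st h; apply/eqP/contraT => p0.
pose n := size p; pose u (i : nat) := s + (t - s) / i.+1%:R.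
have ts : 0 < t - s by rewrite subr_gt0.
have ra : all (root p) (map u (iota 0 n)).
  apply/allP => _ /mapP[i _ ->]; apply/rootP/h; first by rewrite lerDl divr_ge0// ltW.
  by rewrite /u -lerBrDl ler_pdivrMr// ler_peMr ?(ltW ts)// ler1n.
have := max_poly_roots p0 ra; rewrite size_map size_iota ltnn => -> //.
rewrite map_inj_uniq ?iota_uniq// => i j /addrI /(mulfI (lt0r_neq0 ts)) /invr_inj /eqP.
by rewrite eqr_nat => /eqP[].
Qed.

(** Equal values would make the monotone primitive constant on [s, t], hence a constant polynomial.
    This is how the determinant of the separation argument is seen to be positive. *)
Lemma prim_lt (p : {poly R}) (s t : R) : p != 0 -> s < t ->
  (prim (p ^+ 2)).[s] < (prim (p ^+ 2)).[t].
Proof.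
move=> p0 st; set W := prim _.
have mono a b : a <= b -> W.[a] <= W.[b].
  move=> ab; have [|u _] := MVT_segment ab (fun u _ => is_derive_poly W u).
    exact: continuous_subspaceT (@continuous_horner R W).
  rewrite deriv_prim => E; rewrite -subr_ge0 E mulr_ge0 ?subr_ge0//.
  by rewrite horner_exp sqr_ge0.
rewrite lt_neqAle mono ?ltW// andbT; apply: contraNneq p0 => E.
have : W - W.[s]%:P = 0.
  apply: (poly_eq0_segment st) => u su ut; rewrite !hornerE; apply/eqP.
  by rewrite subr_eq0 eq_le {1}E !mono.
move/(congr1 (@deriv _)); rewrite derivB derivC subr0 deriv0 deriv_prim => /eqP.
by rewrite expf_eq0.
Qed.

(** Pigeonhole: if every point of the cube were reached, the [M ^ 3] points of a grid would choose
    parameters among [N ^ 2] cells of a square. Two in the same cell are closer than the grid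
    spacing in all three coordinates. A relation is used because the bad triple depends only on the
    pairs that are far apart. *)
Lemma cube_not_thin (k C d : R) (Rel : R -> R -> R -> R -> R -> Prop) :
  0 <= k -> 0 <= C -> 0 < d ->
  (forall s t s' t' a b c a' b' c', Rel s t a b c -> Rel s' t' a' b' c' ->
    [/\ `|a - a'| <= C * (`|s - s'| + `|t - t'|),
        `|b - b'| <= C * (`|s - s'| + `|t - t'|) &
        `|c - c'| <= C * (`|s - s'| + `|t - t'|)]) ->
  (forall s t a b c, Rel s t a b c -> `|s| <= k /\ `|t| <= k) ->
  exists a b c, [/\ 0 <= a <= d, 0 <= b <= d, 0 <= c <= d & forall s t, ~ Rel s t a b c].
Proof.
move=> k0 C0 d0 hlip hk; apply: contrapT => hn.
have {}hn a b c : 0 <= a <= d -> 0 <= b <= d -> 0 <= c <= d -> exists st : R * R, Rel st.1 st.2 a b c.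
  move=> ha hb hc; apply: contrapT => h; apply: hn; exists a, b, c; split=> // s t hst.
  by apply: h; exists (s, t).
(* Slightly more than the length of [-k, k], so that the endpoint [k] also falls into a cell with
   index below [N]. *)
pose L := 2 * k + 1; have L0 : 0 < L by rewrite ltr_wpDl// mulr_ge0.
pose K := (Num.trunc (2 * C * L / d)).+1.
have KC : 2 * C * L < d * K%:R.
  by rewrite [ltRHS]mulrC -ltr_pdivrMr// /K truncnS_gt.
(* Then [N ^ 2 = K ^ 2 * M ^ 2 < M ^ 3], while [KC] says that the Lipschitz bound [2 * C * L / N] is
   less than the grid spacing [d / M]. *)
pose M := (K ^ 2).+1; pose N := (K * M)%N.
have N0 : 0 < N%:R :> R by rewrite ltr0n muln_gt0.
pose grid (i : 'I_M) : R := d * (i%:R / M%:R).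
have gridP i : 0 <= grid i <= d.
  rewrite /grid mulr_ge0 ?(ltW d0) ?divr_ge0//= ler_piMr ?(ltW d0)//.
  by rewrite ler_pdivrMr// mul1r ler_nat ltnW.
have /choice[st hst] (i : 'I_M * 'I_M * 'I_M) := hn _ _ _ (gridP i.1.1) (gridP i.1.2) (gridP i.2).
pose cell (u : R) := Num.trunc ((u + k) / L * N%:R).
have cell_arg u : `|u| <= k -> 0 <= (u + k) / L * N%:R /\ (cell u < N)%N.
  rewrite ler_norml => /andP[u1 u2].
  have h0 : 0 <= u + k by rewrite -lerBlDr sub0r.
  have h1 : 0 <= (u + k) / L * N%:R by rewrite mulr_ge0 ?divr_ge0 ?(ltW L0).
  split=> //; rewrite /cell -(ltr_nat R) (le_lt_trans (y := (u + k) / L * N%:R)) ?truncn_le//.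
  rewrite gtr_pMl// ltr_pdivrMr// mul1r /L; lra.
have cell_close u v : `|u| <= k -> `|v| <= k -> cell u = cell v -> `|u - v| <= L / N%:R.
  move=> uk vk E; have [u0 _] := cell_arg u uk; have [v0 _] := cell_arg v vk.
  have := trunc_itv u0; have := trunc_itv v0; rewrite -/(cell u) -/(cell v) E.
  move=> /andP[v1 v2] /andP[u1 u2].
  have -> : u - v = ((u + k) / L * N%:R - (v + k) / L * N%:R) * (L / N%:R).
    by field; rewrite !gt_eqF.
  rewrite normrM (ger0_norm (_ : 0 <= L / N%:R)) ?divr_ge0 ?(ltW L0)//.
  rewrite ler_piMl ?divr_ge0 ?(ltW L0)// ler_norml.
  by move: u1 u2 v1 v2; rewrite -!nat1r => u1 u2 v1 v2; apply/andP; split; lra.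
have hk1 i : `|(st i).1| <= k by have [] := hk _ _ _ _ _ (hst i).
have hk2 i : `|(st i).2| <= k by have [] := hk _ _ _ _ _ (hst i).
pose ce (i : 'I_M * 'I_M * 'I_M) : 'I_N * 'I_N :=
  (Ordinal (proj2 (cell_arg _ (hk1 i))), Ordinal (proj2 (cell_arg _ (hk2 i)))).
have grid_inj (i j : 'I_M) : `|grid i - grid j| <= C * (L / N%:R + L / N%:R) -> i = j.
  move=> h; apply: contrapT => /eqP ij.
  have M0 : 0 < M%:R :> R by rewrite ltr0n.
  have h1 : 1 <= `|i%:R - j%:R| :> R.
    move: ij; rewrite -val_eqE /= neq_ltn => /orP[] hij.
      by rewrite distrC ger0_norm ?subr_ge0 ?ler_nat 1?ltnW// lerBrDr nat1r ler_nat.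
    by rewrite ger0_norm ?subr_ge0 ?ler_nat 1?ltnW// lerBrDr nat1r ler_nat.
  have h2 : d / M%:R <= `|grid i - grid j|.
    rewrite /grid -mulrBr -mulrBl !normrM normfV (gtr0_norm d0) (gtr0_norm M0).
    by rewrite ler_pM2l// -[leLHS]mul1r ler_pM2r ?invr_gt0.
  have := le_trans h2 h; rewrite /N natrM.
  have K0 : 0 < K%:R :> R by rewrite ltr0n.
  rewrite (_ : C * _ = 2 * C * L / K%:R / M%:R); last by field; rewrite !gt_eqF.
  by rewrite ler_pM2r ?invr_gt0// ler_pdivlMr// leNgt KC.
have ce_inj : injective ce.
  move=> i j [/(cell_close _ _ (hk1 i) (hk1 j)) e1 /(cell_close _ _ (hk2 i) (hk2 j)) e2].
  have [h1 h2 h3] := hlip _ _ _ _ _ _ _ _ _ _ (hst i) (hst j).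
  have le := ler_wpM2l C0 (lerD e1 e2).
  rewrite [i]surjective_pairing [i.1]surjective_pairing [j]surjective_pairing [j.1]surjective_pairing.
  by rewrite (grid_inj _ _ (le_trans h1 le)) (grid_inj _ _ (le_trans h2 le)) (grid_inj _ _ (le_trans h3 le)).
have := leq_card _ ce_inj; rewrite !card_prod !card_ord /N [leqRHS]mulnACA [leqRHS]mulnC leq_pmul2l ?muln_gt0//.
by rewrite mulnn /M ltnn.
Qed.

End Generic.

(** * Lipschitz functions of separated pairs of parameters *)

Section Lipschitz.
Context {R : realType}.
Context (k eta : R).

(** The distance [eta] from the diagonal keeps the inverse of [t - s] Lipschitz. *)
Definition far (s t : R) := [/\ `|s| <= k, `|t| <= k & s + eta <= t].

(** Boundedness is part of the notion so that it is stable under products. *)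
Definition lip (g : R -> R -> R) := exists2 C, 0 <= C &
  (forall s t, far s t -> `|g s t| <= C) /\
  (forall s t s' t', far s t -> far s' t' -> `|g s t - g s' t'| <= C * (`|s - s'| + `|t - t'|)).

Lemma lip_cst a : lip (fun _ _ => a).
Proof.
exists `|a| => //; split=> // *; rewrite subrr normr0 mulr_ge0// addr_ge0//.
Qed.

Lemma lipD f g : lip f -> lip g -> lip (fun s t => f s t + g s t).
Proof.
move=> [C C0 [f1 f2]] [D D0 [g1 g2]]; exists (C + D); first exact: addr_ge0.
split=> [s t h|s t s' t' h h']; first by rewrite (le_trans (ler_normD _ _))// lerD ?f1 ?g1.
by rewrite opprD addrACA (le_trans (ler_normD _ _))// mulrDl lerD ?f2 ?g2.
Qed.

Lemma lipM f g : lip f -> lip g -> lip (fun s t => f s t * g s t).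
Proof.
move=> [C C0 [f1 f2]] [D D0 [g1 g2]]; exists (2 * C * D); first by rewrite !mulr_ge0.
split=> [s t h|s t s' t' h h'].
  rewrite normrM -mulrA mulr_natl mulr2n (le_trans (ler_pM _ _ (f1 _ _ h) (g1 _ _ h)))//.
  by rewrite lerDl mulr_ge0.
have -> : f s t * g s t - f s' t' * g s' t' =
  f s t * (g s t - g s' t') + (f s t - f s' t') * g s' t' by ring.
rewrite (le_trans (ler_normD _ _))// !normrM.
have := ler_pM (normr_ge0 _) (normr_ge0 _) (f1 _ _ h) (g2 _ _ _ _ h h').
have := ler_pM (normr_ge0 _) (normr_ge0 _) (f2 _ _ _ _ h h') (g1 _ _ h').
set A := `|s - s'| + _; move=> a b; apply: le_trans (lerD b a) _.
by rewrite le_eqVlt; apply/orP; left; apply/eqP; ring.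
Qed.

Lemma lipN f : lip f -> lip (fun s t => - f s t).
Proof.
move=> [C C0 [f1 f2]]; exists C => //; split=> [s t h|s t s' t' h h'].
  by rewrite normrN f1.
by rewrite -opprD normrN f2.
Qed.

Lemma lipB f g : lip f -> lip g -> lip (fun s t => f s t - g s t).
Proof. by move=> hf hg; apply: lipD => //; exact: lipN. Qed.

Lemma lip_fst (p : {poly R}) : lip (fun s _ => p.[s]).
Proof.
elim/poly_ind: p => [|p c ih].
  by have := lip_cst 0; under [in X in _ -> X]eq_fun do (under eq_fun do rewrite horner0).
have hs : lip (fun s _ => s).
  exists (`|k| + 1); first by rewrite addr_ge0.
  split=> [s t [h _ _]|s t s' t' _ _].
    by rewrite (le_trans h)// (le_trans (ler_norm _))// lerDl.
  rewrite -[leLHS]mul1r ler_pM ?lerDl ?lerDr//.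
have -> : (fun s (_ : R) => (p * 'X + c%:P).[s]) = (fun s t => p.[s] * s + c).
  by apply/funext => s; apply/funext => t; rewrite !hornerE.
by apply: lipD; [exact: lipM|exact: lip_cst].
Qed.

Lemma lip_snd (p : {poly R}) : lip (fun _ t => p.[t]).
Proof.
elim/poly_ind: p => [|p c ih].
  by have := lip_cst 0; under [in X in _ -> X]eq_fun do (under eq_fun do rewrite horner0).
have hs : lip (fun _ t => t).
  exists (`|k| + 1); first by rewrite addr_ge0.
  split=> [s t [_ h _]|s t s' t' _ _].
    by rewrite (le_trans h)// (le_trans (ler_norm _))// lerDl.
  rewrite -[leLHS]mul1r ler_pM ?lerDl ?lerDr//.
have -> : (fun (_ t : R) => (p * 'X + c%:P).[t]) = (fun s t => p.[t] * t + c).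
  by apply/funext => s; apply/funext => t; rewrite !hornerE.
by apply: lipD; [exact: lipM|exact: lip_cst].
Qed.

Lemma lip_diff (p : {poly R}) : lip (fun s t => p.[t] - p.[s]).
Proof. by apply: lipB; [exact: lip_snd|exact: lip_fst]. Qed.

Lemma lip_pos_lb g : lip g -> (forall s t, far s t -> 0 < g s t) ->
  exists2 d, 0 < d & forall s t, far s t -> d <= g s t.
Proof.
move=> [C C0 [_ g2]] g0.
pose A : set (R * R) := (`[- k, k] `*` `[- k, k]) `&`
  ((fun p : R * R => p.2 - p.1 - eta) @^-1` [set x | 0 <= x]).
have inA s t : A (s, t) <-> far s t.
  rewrite /A /= !in_itv /= -!ler_norml /far lerBrDr add0r lerBrDl.
  by split=> [[[]]|[]].
have cA : compact A.
  apply: compact_closedI; first by apply: compact_setX; exact: segment_compact.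
  apply: preimage_closed => [p _|]; last exact: closed_ge.
  by apply: cvgB; [apply: cvgB; [exact: cvg_snd|exact: cvg_fst]|exact: cvg_cst].
have [A0|A0] := pselect (A !=set0); last first.
  by exists 1 => // s t h; exfalso; apply: A0; exists (s, t); exact/inA.
have cg : {within A, continuous (fun p : R * R => g p.1 p.2)}.
  apply/subspace_continuousP => -[s t] /inA hA; apply/cvgrPdist_le => e e0.
  pose d := e / (2 * C + 1).
  have C1 : 0 < 2 * C + 1 by rewrite ltr_wpDl// mulr_ge0.
  have d0 : 0 < d by rewrite divr_gt0.
  have : nbhs (s, t) (ball ((s, t) : R * R) d) by exact: nbhsx_ballx.
  rewrite near_withinE; apply: filterS => -[s' t'] [/= b1 b2] /inA hA'.
  apply: le_trans (g2 _ _ _ _ hA hA') _.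
  apply: (@le_trans _ _ (C * (d + d))).
    by rewrite ler_wpM2l// lerD// ltW.
  by rewrite /d -mulrDl mulrA ler_pdivrMr//; nra.
have [[s t] /set_mem/inA h hm] := compact_EVT_min A0 cA cg.
exists (g s t); first exact: g0.
by move=> s' t' h'; apply: (hm (s', t')); apply/mem_set/inA.
Qed.

Lemma lipV g : lip g -> (forall s t, far s t -> 0 < g s t) -> lip (fun s t => (g s t)^-1).
Proof.
move=> hg g0; have [d d0 hd] := lip_pos_lb hg g0.
move: hg => [C C0 [g1 g2]].
have iv s t : far s t -> `|(g s t)^-1| <= d^-1.
  move=> h; rewrite ger0_norm ?invr_ge0 ?(ltW (g0 _ _ h))//.
  by rewrite lef_pV2 ?posrE ?g0 ?hd.
exists (d^-1 + C / d ^+ 2).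
  by rewrite addr_ge0 ?divr_ge0 ?invr_ge0 ?exprn_ge0// ltW.
split=> [s t h|s t s' t' h h'].
  by rewrite (le_trans (iv _ _ h))// lerDl divr_ge0// exprn_ge0// ltW.
have -> : (g s t)^-1 - (g s' t')^-1 = - (g s t - g s' t') * ((g s t)^-1 * (g s' t')^-1).
  by field; rewrite !gt_eqF ?g0.
rewrite normrM normrN (le_trans (y := C * (`|s - s'| + `|t - t'|) * (d^-1 * d^-1)))//.
  by rewrite ler_pM ?g2// normrM ler_pM ?iv.
rewrite mulrAC ler_wpM2r ?addr_ge0// -invfM -expr2 lerDr invr_ge0 ltW//.
Qed.

End Lipschitz.

(** * Small Legendrian perturbations into general position *)

Section GenericPerturbation.
Context {R : realType}.

(** It replaces integrals: an identity between integrals over [s, t] is proved by comparing the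
    derivatives of two polynomials. *)
Lemma prim_diff (u v : {poly R}) (s t : R) : u^`() = v^`() -> u.[t] - u.[s] = v.[t] - v.[s].
Proof.
move=> uv; have h x : is_derive x (1 : R) (horner (u - v)) 0.
  by have := is_derive_poly (u - v) x; rewrite derivB uv subrr horner0.
have := is_derive_0_is_cst s t h; rewrite !hornerE => e; lra.
Qed.

(** The correction [z] is forced up to a constant, so it is described by its derivative; only its
    increments matter for injectivity. The radius [r + 1] pays for the derivative of [q]. *)
Lemma legendrian_perturbation m (j0 : 'I_m) (F : idx m -> {poly R}) (r d : R) :
  0 < r -> 0 < d -> pcontact F = 0 ->
  exists2 del, 0 < del & forall p q : {poly R}, pnorm (r + 1) p <= del -> pnorm (r + 1) q <= del ->
  exists2 F' : idx m -> {poly R}, pcontact F' = 0 &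
    [/\ F' (ix j0) = F (ix j0) + p, F' (iy j0) = F (iy j0) + q,
        exists2 z, F' iz = F iz - z &
          z^`() = F (ix j0) * q^`() + p * (F (iy j0))^`() + p * q^`() &
        forall i, pnorm r (F' i - F i) <= d].
Proof.
move=> r0 d0 F0; set x := F (ix j0); set y := F (iy j0).
have r0' := ltW r0.
have n0 p : 0 <= pnorm r p by rewrite pnorm_ge0.
pose Z := 1 + r * (pnorm r x + pnorm r y^`() + 1).
have Z1 : 1 <= Z by rewrite /Z lerDl mulr_ge0 ?addr_ge0.
have Z0 : 0 < Z by rewrite (lt_le_trans _ Z1).
exists (Num.min 1 (d / Z)); first by rewrite lt_min ltr01 divr_gt0.
set del := Num.min _ _ => p q hp hq.
have del1 : del <= 1 by rewrite ge_min lexx.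
have del0 : 0 <= del by rewrite (le_trans _ hp)// pnorm_ge0 ?addr_ge0.
have delZ : Z * del <= d by rewrite mulrC -ler_pdivlMr// ge_min lexx orbT.
have dd : del <= d by rewrite (le_trans _ delZ)// ler_peMl.
have rr : r <= r + 1 by rewrite lerDl.
have pr := le_trans (pnorm_le p r0' rr) hp.
have qr := le_trans (pnorm_le q r0' rr) hq.
have q'r : pnorm r q^`() <= del by rewrite (le_trans (pnorm_deriv _ r0' (@ltr01 R)))// divr1.
pose w := x * q^`() + p * y^`() + p * q^`().
have hw : pnorm r w <= (pnorm r x + pnorm r y^`() + 1) * del.
  rewrite /w (le_trans (pnormD _ _ r0'))// mulrDl lerD//; last first.
    by rewrite (le_trans (pnormM _ _ r0'))// ler_pM// (le_trans pr).
  rewrite (le_trans (pnormD _ _ r0'))// mulrDl lerD// (le_trans (pnormM _ _ r0'))//.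
    by rewrite ler_wpM2l.
  by rewrite mulrC ler_wpM2l.
exists (perturb j0 F p q (prim w)).
  by rewrite pcontact_perturb F0 deriv_prim -/x -/y /w add0r subrr.
split.
- by rewrite /= eqxx.
- by rewrite /= eqxx.
- by exists (prim w) => //; rewrite deriv_prim.
apply: perturb_le => [|u|||]; [by rewrite pnorm0 ltW|exact: pnormN|exact: le_trans pr dd
  |exact: le_trans qr dd|].
rewrite (le_trans (pnorm_prim _ r0'))// (le_trans _ delZ)//.
rewrite (le_trans (ler_wpM2l r0' hw))// mulrA ler_wpM2r// /Z lerDr//.
Qed.

(** Degree at least 2 is what makes [y + nu X - c] nonzero for all [nu] and [c] in the separation
    argument, and the derivative of [y] nonzero in the immersion argument. *)
Lemma nonaffine_perturbation m (j0 : 'I_m) (F : idx m -> {poly R}) (r d : R) :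
  0 < r -> 0 < d -> pcontact F = 0 ->
  exists F' : idx m -> {poly R}, [/\ pcontact F' = 0, forall i, pnorm r (F' i - F i) <= d &
    (2 < size (F' (iy j0)))%N].
Proof.
move=> r0 d0 F0; have [h|h] := ltnP 2 (size (F (iy j0))).
  by exists F; split=> // i; rewrite subrr pnorm0 ltW.
have [del del0 hdel] := legendrian_perturbation j0 r0 d0 F0.
have r1 : 0 < r + 1 by rewrite addr_gt0.
pose a := del / (r + 1) ^+ 2.
have a0 : 0 < a by rewrite divr_gt0 ?exprn_gt0.
have [||F' F'0 [_ hy _ hF']] := hdel 0 (a *: 'X^2).
- by rewrite pnorm0 ltW.
- rewrite (le_trans (pnormZ _ _ (ltW r1)))// pnormXn ?(ltW r1)// gtr0_norm//.
  by rewrite /a divfK// gt_eqF ?exprn_gt0.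
exists F'; split=> //; rewrite hy addrC size_polyDl size_scale ?gt_eqF// size_polyXn//.
Qed.

(** Adding [a X] to [x] fails only if some zero of the derivative of [y] is a zero of the derivative
    of [x] plus [a]. Different values of [a] need different zeros, and there are finitely many, so
    one of the infinitely many small constants [a i] works. *)
Lemma immersed_perturbation m (j0 : 'I_m) (F : idx m -> {poly R}) (r d : R) :
  0 < r -> 0 < d -> pcontact F = 0 -> (2 < size (F (iy j0)))%N ->
  exists F' : idx m -> {poly R}, [/\ pcontact F' = 0, forall i, pnorm r (F' i - F i) <= d,
    (2 < size (F' (iy j0)))%N &
    forall t, 0 < `|(F' (ix j0))^`().[t]| + `|(F' (iy j0))^`().[t]|].
Proof.
move=> r0 d0 F0 sy.
have [del del0 hdel] := legendrian_perturbation j0 r0 d0 F0.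
have r1 : 0 < r + 1 by rewrite addr_gt0.
pose a i : R := del / (r + 1) / i.+1%:R.
have a0 i : 0 < a i by rewrite !divr_gt0.
set x := F (ix j0) in hdel *; set y := F (iy j0) in sy hdel *.
have y'0 : y^`() != 0.
  apply/eqP => y0; move: sy; have -> : y = (y.[0])%:P.
    apply/eqP; rewrite -subr_eq0; apply/eqP/(@poly_eq0_segment _ _ 0 1) => // u _ _.
    by rewrite !hornerE (prim_diff (v := 0) 0 u) ?deriv0// !horner0 subrr.
  by rewrite size_polyC; case: eqP.
have [i hi] : exists i, forall t, y^`().[t] = 0 -> x^`().[t] + a i != 0.
  apply: contrapT => hn.
  have /choice[t ht] i : exists t, y^`().[t] = 0 /\ x^`().[t] + a i = 0.
    apply: contrapT => h; apply: hn; exists i => t yt; apply/eqP => xt.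
    by apply: h; exists t.
  pose n := size y^`().
  have ra : all (root y^`()) (map t (iota 0 n)).
    by apply/allP => _ /mapP[i _ ->]; apply/rootP; have [] := ht i.
  have := max_poly_roots y'0 ra; rewrite size_map size_iota ltnn => H; suff : false by []; apply: H.
  rewrite map_inj_uniq ?iota_uniq// => i1 i2 e.
  have [_ e1] := ht i1; have [_ e2] := ht i2.
  have : a i1 = a i2 by apply: (addrI x^`().[t i1]); rewrite e1 e e2.
  have c0 : del / (r + 1) != 0 by rewrite gt_eqF// divr_gt0.
  by move=> /(mulfI c0) /invr_inj /eqP; rewrite eqr_nat => /eqP[].
have [||F' F'0 [hx hy _ hF']] := hdel (a i *: 'X) 0.
- rewrite (le_trans (pnormZ _ _ (ltW r1)))// pnormX ?(ltW r1)// gtr0_norm//.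
  rewrite /a mulrAC divfK ?gt_eqF// ler_pdivrMr// ler_peMr ?(ltW del0)// ler1n//.
- by rewrite pnorm0 ltW.
exists F'; split=> //; first by rewrite hy addr0.
move=> t; rewrite hx hy addr0 derivD derivZ derivX !hornerE.
rewrite lt_neqAle addr_ge0// andbT eq_sym paddr_eq0// !normr_eq0.
by apply/negP => /andP[/eqP h1 /eqP h2]; have := hi t h2; rewrite h1 eqxx.
Qed.

(* Two points [s < t] with the same image under the curve perturbed by
   [y += nu X], [x += la X + 2 mu X (y + nu X)] determine [nu], then [mu] and
   [la], since the determinant of the linear system for [(la, mu)] is
   [D = int_s^t (y + nu X - c)^2 > 0], where [c] is the common value of
   [y + nu X] at [s] and [t].  So the bad parameters form a Lipschitz image of
   a planar set. *)
Lemma separated_perturbation m (j0 : 'I_m) (F : idx m -> {poly R}) (k eta d : R) :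
  0 <= k -> 0 < eta -> 0 < d -> (2 < size (F (iy j0)))%N ->
  exists nu mu la, [/\ 0 <= nu <= d, 0 <= mu <= d, 0 <= la <= d &
  forall (F' : idx m -> {poly R}) (z p q : {poly R}),
    q = nu *: 'X -> p = la *: 'X + (2 * mu) *: ('X * (F (iy j0) + q)) ->
    F' (ix j0) = F (ix j0) + p -> F' (iy j0) = F (iy j0) + q -> F' iz = F iz - z ->
    z^`() = F (ix j0) * q^`() + p * (F (iy j0))^`() + p * q^`() ->
    forall s t, far k eta s t -> exists i, (F' i).[s] != (F' i).[t]].
Proof.
move=> k0 eta0 d0 sy; set x := F (ix j0); set y := F (iy j0) in sy *.
pose ell (s t : R) := t - s.
pose nu s t := - (y.[t] - y.[s]) * (ell s t)^-1.
pose c s t := y.[s] + nu s t * s.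
(* [S1] and [S2] are the integrals over [s, t] of [y + nu X] and of its square. *)
pose S1 s t := ((prim y).[t] - (prim y).[s]) + nu s t * ((prim 'X).[t] - (prim 'X).[s]).
pose S2 s t := ((prim (y ^+ 2)).[t] - (prim (y ^+ 2)).[s]) +
  2 * nu s t * ((prim ('X * y)).[t] - (prim ('X * y)).[s]) +
  nu s t * nu s t * ((prim ('X ^+ 2)).[t] - (prim ('X ^+ 2)).[s]).
pose D s t := S2 s t - 2 * c s t * S1 s t + c s t * c s t * ell s t.
pose dx s t := x.[t] - x.[s].
(* Integrating by parts, equality of the [z] coordinates says that the increment of [F iz] minus
   [nu] times the integral of [x] is [la (ell c - S1) + mu (ell c^2 - S2)]. Eliminating [la] by the
   equation for [x] leaves [A = - mu D]. *)
pose A s t := ((F iz).[t] - (F iz).[s]) - nu s t * ((prim x).[t] - (prim x).[s])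
  + dx s t * (ell s t)^-1 * (ell s t * c s t - S1 s t).
pose mu s t := - A s t * (D s t)^-1.
pose la s t := - dx s t * (ell s t)^-1 - 2 * mu s t * c s t.
have ell0 s t : far k eta s t -> 0 < ell s t.
  by move=> [_ _]; rewrite /ell => h; lra.
have Llell : lip k eta ell.
  have := lip_diff k eta 'X; rewrite (_ : (fun s t => _) = ell)//.
  by apply/funext => s; apply/funext => t; rewrite !hornerX.
have Lid : lip k eta (fun s _ => s).
  have := lip_fst k eta 'X; rewrite (_ : (fun s _ => _) = (fun s _ => s))//.
  by apply/funext => s; apply/funext => t; rewrite hornerX.
have Liell := lipV Llell ell0.
have L2 f : lip k eta f -> lip k eta (fun s t => 2 * f s t) by apply: lipM; exact: lip_cst.
have Lnu : lip k eta nu by apply: lipM Liell; apply: lipN; exact: lip_diff.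
have Lc : lip k eta c by apply: lipD; [exact: lip_fst|exact: lipM].
have LS1 : lip k eta S1.
  by apply: lipD; [exact: lip_diff|apply: lipM => //; exact: lip_diff].
have LS2 : lip k eta S2.
  apply: lipD; last by apply: lipM; [exact: lipM|exact: lip_diff].
  by apply: lipD; [exact: lip_diff|apply: lipM; [exact: L2|exact: lip_diff]].
have LD : lip k eta D.
  apply: lipD; last by apply: lipM => //; exact: lipM.
  by apply: lipB => //; apply: lipM => //; exact: L2.
have Ldx : lip k eta dx by exact: lip_diff.
have LA : lip k eta A.
  apply: lipD; last by apply: lipM; [exact: lipM|apply: lipB => //; exact: lipM].
  by apply: lipB; [exact: lip_diff|apply: lipM => //; exact: lip_diff].
have D0 s t : far k eta s t -> 0 < D s t.
  move=> h; have st : s < t by rewrite -subr_gt0; exact: ell0 h.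
  pose n := nu s t; pose c0 := c s t.
  have yn0 : y + n *: 'X - c0%:P != 0.
    have : (1 < size (y + n *: 'X - c0%:P)%R)%N.
      rewrite -addrA size_polyDl; first exact: ltnW.
      apply: leq_ltn_trans sy; rewrite -polyCN (leq_trans (size_polyD _ _))// geq_max.
      rewrite (leq_trans (size_scale_leq _ _)) ?size_polyX//.
      by rewrite (leq_trans (size_polyC_leq1 _)).
    by apply: contraTneq => ->; rewrite size_poly0.
  have := prim_lt yn0 st; rewrite -subr_gt0; congr (_ < _).
  pose V := prim (y ^+ 2) + (2 * n) *: prim ('X * y) + (n * n) *: prim ('X ^+ 2)
    - (2 * c0) *: (prim y + n *: prim 'X) + (c0 * c0) *: 'X.
  rewrite (prim_diff (v := V)).
    by rewrite /V !(hornerD, hornerN, hornerZ, hornerX) /D /S1 /S2 -/n -/c0 /ell; ring.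
  rewrite /V !(derivD, derivN, derivZ, derivX) !deriv_prim -!mul_polyC !polyCM; ring.
have Lmu : lip k eta mu by apply: lipM; [exact: lipN|exact: lipV].
have Lla : lip k eta la.
  apply: lipB; last by apply: lipM => //; exact: L2.
  by apply: lipM => //; exact: lipN.
move: Lnu Lmu Lla => [C1 C10 [_ h1]] [C2 C20 [_ h2]] [C3 C30 [_ h3]].
pose C := C1 + C2 + C3.
have C0 : 0 <= C by rewrite !addr_ge0.
pose Rel s t a b e := [/\ far k eta s t, a = nu s t, b = mu s t & e = la s t].
have Rlip s t s' t' a b e a' b' e' : Rel s t a b e -> Rel s' t' a' b' e' ->
    [/\ `|a - a'| <= C * (`|s - s'| + `|t - t'|),
        `|b - b'| <= C * (`|s - s'| + `|t - t'|) &
        `|e - e'| <= C * (`|s - s'| + `|t - t'|)].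
  move=> [h -> -> ->] [h' -> -> ->].
  have n0 : 0 <= `|s - s'| + `|t - t'| by rewrite addr_ge0.
  by split; [apply: le_trans (h1 _ _ _ _ h h') _|apply: le_trans (h2 _ _ _ _ h h') _
    |apply: le_trans (h3 _ _ _ _ h h') _]; rewrite ler_wpM2r// /C; lra.
have Rk s t a b e : Rel s t a b e -> `|s| <= k /\ `|t| <= k by move=> [[]].
have [a [b [e [ha hb he hn]]]] := cube_not_thin k0 C0 d0 Rlip Rk.
exists a, b, e; split=> // F' z p q qE pE hx hy hz z'E s t h.
apply: contrapT => hne.
have eqF i : (F' i).[s] = (F' i).[t].
  by apply: contrapT => /eqP hi; apply: hne; exists i.
have l0 := ell0 s t h; have ln : t - s != 0 by rewrite gt_eqF.
apply: (hn s t); have aE : a = nu s t.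
  have := eqF (iy j0); rewrite hy qE !hornerE => e1.
  by apply: (mulIf ln); rewrite /nu /ell divfK//; lra.
have cs : y.[s] + a * s = c s t by rewrite /c aE.
have ct : y.[t] + a * t = c s t.
  by have := eqF (iy j0); rewrite hy qE !hornerE cs => ->.
have E1 : dx s t = - (e + 2 * b * c s t) * ell s t.
  have := eqF (ix j0); rewrite hx pE qE !(hornerD, hornerZ, hornerM, hornerX) cs ct.
  by rewrite /dx /ell; lra.
have eE : e = - dx s t * (ell s t)^-1 - 2 * b * c s t.
  by rewrite E1; field; rewrite gt_eqF.
pose Y := y + a *: 'X.
(* The integration by parts in polynomial form: [V] has the same derivative as [z], and its
   increment involves only [prim] terms and the boundary values of [Y], which are both [c s t]. *)
pose V := a *: prim x + e *: ('X * Y - (prim y + a *: prim 'X)) + b *: ('X * Y ^+ 2 -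
  (prim (y ^+ 2) + (2 * a) *: prim ('X * y) + (a * a) *: prim ('X ^+ 2))).
have E2 : (F iz).[t] - (F iz).[s] = V.[t] - V.[s].
  have -> : V.[t] - V.[s] = z.[t] - z.[s].
    apply: prim_diff; rewrite z'E pE qE /V /Y expr2.
    rewrite !(derivD, derivN, derivZ, derivX, derivM) !deriv_prim -!mul_polyC !polyCM; ring.
  by have := eqF iz; rewrite hz !hornerE; lra.
have E3 : A s t = - b * D s t.
  rewrite /A E2 /V /Y !(hornerD, hornerN, hornerZ, hornerM, hornerX, horner_exp) cs ct.
  rewrite (_ : dx s t / ell s t = - (e + 2 * b * c s t)); last by rewrite E1; field; rewrite gt_eqF.
  rewrite /D /S1 /S2 -aE /ell; ring.
have bE : b = mu s t by rewrite /mu E3; field; rewrite gt_eqF ?D0.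
by split=> //; rewrite /la -bE.
Qed.

End GenericPerturbation.

(** * The approximating sequence *)

Section Assembly.
Context {R : realType}.

(** The distance [eta] is read off from the immersed curve [F2] before the last perturbation. That
    one separates the pairs at distance at least [eta], and it is kept so small in C^1 that closer
    pairs remain separated. *)
Lemma generic_perturbation m (j0 : 'I_m) (F : idx m -> {poly R}) (r k d : R) :
  0 < r -> 0 <= k -> 0 < d -> pcontact F = 0 ->
  exists F' : idx m -> {poly R}, [/\ pcontact F' = 0, forall i, pnorm r (F' i - F i) <= d,
    forall t, `|t| <= k -> 0 < `|(F' (ix j0))^`().[t]| + `|(F' (iy j0))^`().[t]| &
    forall s t, `|s| <= k -> `|t| <= k -> s < t -> exists i, (F' i).[s] != (F' i).[t]].
Proof.
move=> r0 k0 d0 F0; have d30 : 0 < d / 3 by rewrite divr_gt0.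
have [F1 [F10 F1d s1]] := nonaffine_perturbation j0 r0 d30 F0.
have [F2 [F20 F2d s2 imm]] := immersed_perturbation r0 d30 F10 s1.
have [eta [m0 [eta0 m00 hnear]]] := near_injective (fun t (_ : `|t| <= k) => imm t).
(* Radius [k + 1] bounds derivatives on [-k, k] by Cauchy's estimate. *)
pose r' := Num.max r (k + 1).
have rr' : r <= r' by rewrite le_max lexx.
have kr' : k + 1 <= r' by rewrite le_max lexx orbT.
have r'0 : 0 < r' by rewrite (lt_le_trans r0).
have d'0 : 0 < Num.min (d / 3) m0 by rewrite lt_min d30.
have [del del0 hdel] := legendrian_perturbation j0 r'0 d'0 F20.
pose Q := r' + 1; have Q0 : 0 <= Q by rewrite addr_ge0// ltW.
set y := F2 (iy j0) in s2 *.
pose Z := 1 + Q + 2 * (Q * (pnorm Q y + Q)).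
have Y0 : 0 <= pnorm Q y by rewrite pnorm_ge0.
have Z1 : 1 <= Z by rewrite /Z -addrA lerDl addr_ge0// !mulr_ge0// addr_ge0.
have Z0 : 0 < Z by rewrite (lt_le_trans _ Z1).
pose e := Num.min 1 (del / Z).
have e0 : 0 < e by rewrite lt_min ltr01 divr_gt0.
have e1 : e <= 1 by rewrite ge_min lexx.
have eZ : Z * e <= del by rewrite mulrC -ler_pdivlMr// ge_min lexx orbT.
have [nu [mu [la [hnu hmu hla hsep]]]] := separated_perturbation k0 eta0 e0 s2.
pose q : {poly R} := nu *: 'X.
pose p : {poly R} := la *: 'X + (2 * mu) *: ('X * (y + q)).
move: hnu hmu hla => /andP[nu0 nue] /andP[mu0 mue] /andP[la0 lae].
have hq : pnorm Q q <= e * Q.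
  by rewrite (le_trans (pnormZ _ _ Q0))// pnormX// (ger0_norm nu0) ler_wpM2r.
have hq' : pnorm Q q <= Q by rewrite (le_trans hq)// ler_piMl.
have hp : pnorm Q p <= e * Q + 2 * e * (Q * (pnorm Q y + Q)).
  rewrite (le_trans (pnormD _ _ Q0))// lerD//.
    by rewrite (le_trans (pnormZ _ _ Q0))// pnormX// (ger0_norm la0) ler_wpM2r.
  rewrite (le_trans (pnormZ _ _ Q0))// ger0_norm ?mulr_ge0// ler_pM ?pnorm_ge0 ?mulr_ge0//.
    by rewrite ler_wpM2l.
  rewrite (le_trans (pnormM _ _ Q0))// pnormX// ler_wpM2l//.
  by rewrite (le_trans (pnormD _ _ Q0))// lerD2l.
have qdel : pnorm Q q <= del.
  rewrite (le_trans _ eZ)// (le_trans hq)// mulrC ler_wpM2r ?(ltW e0)// /Z.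
  by rewrite addrAC lerDr addr_ge0// !mulr_ge0// addr_ge0.
have pdel : pnorm Q p <= del.
  rewrite (le_trans _ eZ)// (le_trans hp)// /Z.
  by move: e0; nra.
have [F' F'0 [hx hy [z hz z'E] hF']] := hdel p q pdel qdel.
have kF' i t : `|t| <= k -> `|(F' i)^`().[t] - (F2 i)^`().[t]| <= m0.
  move=> tk; rewrite -hornerN -hornerD -derivB (le_trans (horner_pnorm _ tk))//.
  rewrite (le_trans (pnorm_deriv _ k0 (@ltr01 R)))// divr1.
  rewrite (le_trans (pnorm_le _ _ kr')) ?addr_ge0// (le_trans (hF' i))//.
  by rewrite ge_min lexx orbT.
have [||imm' inj'] := hnear _ _ _ _ (is_derive_poly (F' (ix j0))) (is_derive_poly (F' (iy j0))).
- by move=> t; exact: kF'.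
- by move=> t; exact: kF'.
exists F'; split=> //.
  move=> i; rewrite -[F' i](subrK (F2 i)) -addrA (le_trans (pnormD _ _ (ltW r0)))//.
  rewrite -[F2 i](subrK (F1 i)) -[X in _ + pnorm _ X]addrA.
  have h1 : pnorm r (F' i - F2 i) <= d / 3.
    by rewrite (le_trans (pnorm_le _ (ltW r0) rr'))// (le_trans (hF' i))// ge_min lexx.
  have := pnormD (F2 i - F1 i) (F1 i - F i) (ltW r0); rewrite !addrA !subrK.
  by have := F1d i; have := F2d i; lra.
move=> s t sk tk st; have [ts|ts] := ltP (t - s) eta.
  apply: contrapT => hn.
  have eqF i : (F' i).[s] = (F' i).[t] by apply: contrapT => /eqP hi; apply: hn; exists i.
  exact: (inj' s t).
apply: (hsep F' z p q) => //; split=> //; lra.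
Qed.

Section Target.
Context (m : nat) (j0 : 'I_m) (f0 : idx m -> R -> R) (e : R -> R).
Context (cf : forall i, continuous (f0 i)) (ce : continuous e) (e0 : forall t, 0 < e t).

Lemma refine_curve (F : idx m -> {poly R}) (r s c k d : R) :
  0 < r -> r < s -> s <= c -> 0 <= k -> 0 < d -> pcontact F = 0 ->
  (forall i t, `|t| <= s -> `|(F i).[t] - f0 i t| < e t) ->
  exists F' : idx m -> {poly R}, [/\ pcontact F' = 0, forall i, pnorm r (F' i - F i) <= d,
    forall i t, `|t| <= c -> `|(F' i).[t] - f0 i t| < e t,
    forall t, `|t| <= k -> 0 < `|(F' (ix j0))^`().[t]| + `|(F' (iy j0))^`().[t]| &
    forall s t, `|s| <= k -> `|t| <= k -> s < t -> exists i, (F' i).[s] != (F' i).[t]].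
Proof.
move=> r0 rs sc k0 d0 F0 hF; have d20 : 0 < d / 2 by rewrite divr_gt0.
have [F1 [F10 F1d hF1]] := legendrian_step j0 cf ce e0 r0 rs sc d20 F0 hF.
have [tau tau0 htau] := margin cf ce hF1.
have c0 : 0 < c by rewrite (lt_le_trans _ sc)// (lt_trans r0).
have rc : r <= c by rewrite (le_trans (ltW rs)).
have d'0 : 0 < Num.min (d / 2) (tau / 2) by rewrite lt_min d20 divr_gt0.
have [F' [F'0 F'd imm inj]] := generic_perturbation j0 c0 k0 d'0 F10.
exists F'; split=> // [i|i t tc].
  rewrite -[F' i](subrK (F1 i)) -addrA (le_trans (pnormD _ _ (ltW r0)))//.
  rewrite [leRHS]splitr lerD// (le_trans (pnorm_le _ (ltW r0) rc))//.
  by rewrite (le_trans (F'd i))// ge_min lexx.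
have h1 : `|(F' i - F1 i).[t]| <= tau / 2.
  by rewrite (le_trans (horner_pnorm _ tc))// (le_trans (F'd i))// ge_min lexx orbT.
move: h1; rewrite hornerD hornerN => h1.
rewrite -[(F' i).[t]](subrK (F1 i).[t]) -addrA (le_lt_trans (ler_normD _ _))//.
by have := htau i t tc; move: tau0; lra.
Qed.

(** A constant curve is Legendrian, and continuity makes it admissible near 0; this starts the
    induction. *)
Lemma local_constant_curve : exists s F, [/\ 0 < s, pcontact F = 0 &
  forall i t, `|t| <= s -> `|(F i).[t] - f0 i t| < e t].
Proof.
have H i : nbhs (0 : R) [set t | 0 < e t - `|f0 i 0 - f0 i t|].
  have cg : (fun t => e t - `|f0 i 0 - f0 i t|) @ (0 : R) --> e 0 - `|f0 i 0 - f0 i 0|.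
    apply: cvgB; first exact: ce.
    by apply: cvg_norm; apply: cvgB; [exact: cvg_cst|exact: cf].
  by apply: (cvgr_gt _ cg); rewrite subrr normr0 subr0 e0.
have /nbhs_ballP[s /= s0 hs] : nbhs (0 : R) [set t | forall i, 0 < e t - `|f0 i 0 - f0 i t|].
  exact: (@filter_forall R (idx m) _ (nbhs (0 : R)) _ H).
exists (s / 2), (fun i => (f0 i 0)%:P); split.
- by rewrite divr_gt0.
- by rewrite /pcontact derivC add0r big1// => j _; rewrite derivC mulr0.
move=> i t ts; rewrite hornerC -subr_gt0; apply: hs.
by rewrite /ball /= sub0r normrN (le_lt_trans ts)// ltr_pdivrMr// ltr_pMr// ltr1n.
Qed.

Definition C1_near (k d : R) (F : idx m -> {poly R}) (g dg : idx m -> R -> R) :=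
  [/\ forall i (t : R), is_derive t (1 : R) (g i) (dg i t),
      forall i t, `|t| <= k -> `|g i t - (F i).[t]| <= d &
      forall i t, `|t| <= k -> `|dg i t - (F i)^`().[t]| <= d].

Definition good_on (k : R) (g dg : idx m -> R -> R) :=
  [/\ forall i t, `|t| <= k -> `|g i t - f0 i t| < e t,
      forall t, `|t| <= k -> 0 < `|dg (ix j0) t| + `|dg (iy j0) t| &
      forall s t, `|s| <= k -> `|t| <= k -> s < t -> exists i, g i s != g i t].

(* [st.2] is a budget for the sum of all later changes. *)
Definition stage (k : nat) (st : (idx m -> {poly R}) * R) :=
  [/\ pcontact st.1 = 0, 0 < st.2,
      forall i t, `|t| <= k.+2%:R -> `|(st.1 i).[t] - f0 i t| < e t &
      forall g dg, C1_near k%:R st.2 st.1 g dg -> good_on k%:R g dg].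

Lemma stage_refine (k : nat) (F : idx m -> {poly R}) (r s d b : R) :
  0 < r -> r < s -> s <= k.+2%:R -> 0 < d -> 0 < b -> pcontact F = 0 ->
  (forall i t, `|t| <= s -> `|(F i).[t] - f0 i t| < e t) ->
  exists st, [/\ stage k st, st.2 <= b & forall i, pnorm r (st.1 i - F i) <= d].
Proof.
move=> r0 rs sc d0 b0 F0 hF.
have [F' [F'0 F'd hF' imm inj]] := refine_curve r0 rs sc (ler0n R k) d0 F0 hF.
have [d1 d10 hd1] := stability imm inj.
have [tau tau0 htau] := margin cf ce hF'.
(* [b] is the prescribed bound, [d1] protects the injective immersion, and [tau / 2] protects the
   strict approximation. *)
pose mu := Num.min b (Num.min d1 (tau / 2)).
have mu0 : 0 < mu by rewrite !lt_min b0 d10 divr_gt0.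
exists (F', mu); split=> //=; last by rewrite ge_min lexx.
split=> //= g dg [hg hgF hdg].
have md1 : mu <= d1 by rewrite !ge_min lexx orbT.
have [||imm' inj'] := hd1 g dg hg.
- by move=> i t tk; rewrite (le_trans (hgF i t tk)).
- by move=> i t tk; rewrite (le_trans (hdg i t tk)).
split=> // i t tk.
have tk2 : `|t| <= k.+2%:R by rewrite (le_trans tk)// ler_nat (leq_trans (leqnSn _)).
have mt : mu <= tau / 2 by rewrite !ge_min lexx !orbT.
rewrite -[g i t](subrK (F' i).[t]) -addrA (le_lt_trans (ler_normD _ _))//.
by have := htau i t tk2; have := hgF i t tk; move: tau0; lra.
Qed.

Lemma limit_curve : exists P : idx m -> nat -> {poly R},
  [/\ forall i, pcauchy (P i), forall k, pcontact (fun i => P i k) = 0 &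
      forall k : nat, good_on k%:R (fun i => plim (P i)) (fun i => plim (fun l => (P i l)^`()))].
Proof.
have [s [F [s0 F0 hF]]] := local_constant_curve.
pose s' := Num.min s 1.
have s'0 : 0 < s' by rewrite lt_min s0 ltr01.
have [st0 [st00 _ _]] : exists st, [/\ stage 0 st, st.2 <= 1 &
    forall i, pnorm (s' / 2) (st.1 i - F i) <= 1].
  apply: (@stage_refine _ _ _ s') => //.
  - by rewrite divr_gt0.
  - by rewrite ltr_pdivrMr// ltr_pMr// ltr1n.
  - by rewrite ge_min ler1n orbT.
  - by move=> i t ts; apply: hF; rewrite (le_trans ts)// ge_min lexx.
(* An implication, so that the choice function may be defined on all pairs, stages or not. *)
pose next (a : nat * ((idx m -> {poly R}) * R)) st' := stage a.1 a.2 ->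
  [/\ stage a.1.+1 st', st'.2 <= a.2.2 / 2 &
      forall i, pnorm a.1.+1%:R (st'.1 i - a.2.1 i) <= a.2.2 / 2].
have /choice[nxt hnxt] a : exists st', next a st'.
  have [h|h] := pselect (stage a.1 a.2); last by exists a.2 => /h.
  have [h1 h2 h3 _] := h.
  have m20 : 0 < a.2.2 / 2 by rewrite divr_gt0.
  (* From stage k to stage k + 1: the change is measured at radius k + 1, the old approximation
     holds on [-k-2, k+2], the new one reaches k + 3. *)
  have r0 : 0 < a.1.+1%:R :> R by rewrite ltr0n.
  have rs : a.1.+1%:R < a.1.+2%:R :> R by rewrite ltr_nat.
  have sc : a.1.+2%:R <= a.1.+3%:R :> R by rewrite ler_nat.
  by have [st' hst'] := stage_refine r0 rs sc m20 m20 h1 h3; exists st'.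
pose st := fix st k := if k is k'.+1 then nxt (k', st k') else st0.
have hst k : stage k (st k).
  by elim: k => [//|k ih] /=; have [] := hnxt (k, st k) ih.
have mu0 k : 0 < (st k).2 by have [] := hst k.
have mu2 k : (st k.+1).2 <= (st k).2 / 2 by have [] := hnxt (k, st k) (hst k).
have stepn k i : pnorm k.+1%:R ((st k.+1).1 i - (st k).1 i) <= (st k).2 / 2.
  by have [_ _] := hnxt (k, st k) (hst k).
(* Each step spends at most half of the current budget, and the next budget is at most the other
   half; so the sum telescopes. *)
have dist k j i : (k <= j)%N -> pnorm k.+1%:R ((st j).1 i - (st k).1 i) <= (st k).2 - (st j).2.
  elim: j => [|j ih]; first by rewrite leqn0 => /eqP->; rewrite !subrr pnorm0.
  rewrite leq_eqVlt => /orP[/eqP<-|]; first by rewrite !subrr pnorm0.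
  rewrite ltnS => kj; rewrite -[(st j.+1).1 i](subrK ((st j).1 i)) -addrA.
  rewrite (le_trans (pnormD _ _ (ler0n _ _)))//.
  have kj1 : k.+1%:R <= j.+1%:R :> R by rewrite ler_nat.
  have := le_trans (pnorm_le ((st j.+1).1 i - (st j).1 i) (ler0n _ _) kj1) (stepn j i).
  by have := ih kj; have := mu2 j; lra.
have dist' k j i : (k <= j)%N -> pnorm k.+1%:R ((st j).1 i - (st k).1 i) <= (st k).2.
  by move=> kj; rewrite (le_trans (dist k j i kj))// gerBl ltW.
have mu_exp k : (st k).2 <= (1 / 2) ^+ k * (st 0%N).2.
  elim: k => [|k ih]; first by rewrite expr0 mul1r.
  by rewrite (le_trans (mu2 k))// exprS; move: ih; lra.
pose P i k := (st k).1 i.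
have Pc i : pcauchy (P i).
  move=> r d r0 d0.
  have h0 : 0 < d / 2 / (st 0%N).2 by rewrite !divr_gt0.
  have [a ha] := @exists_small_expr R (1 / 2) _ ltac:(lra) ltac:(lra) h0.
  pose K := maxn a (Num.trunc r).+1.
  have muK : (st K).2 <= d / 2.
    rewrite (le_trans (mu_exp K))// -ler_pdivlMr// (le_trans _ ha)//.
    by apply: ler_wiXn2l; rewrite ?leq_maxl//; lra.
  have rK : r <= K.+1%:R.
    rewrite (le_trans (ltW (truncnS_gt r)))// ler_nat (leq_trans (leq_maxr a _))//.
  exists K => j k Kj Kk; rewrite (le_trans (pnorm_le _ r0 rK))//.
  rewrite /P -[(st j).1 i](subrK ((st K).1 i)) -addrA.
  rewrite (le_trans (pnormD _ _ (ler0n _ _)))// [X in _ + X]pnorm_distC.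
  by have := dist' K j i Kj; have := dist' K k i Kk; lra.
exists P; split=> // k; first by have [] := hst k.
have [_ _ _] := hst k; apply; split.
- by move=> i t; exact: is_derive_plim.
- move=> i t tk; apply: (plim_dist (Pc i) tk) => j kj.
  rewrite (le_trans _ (dist' k j i kj))// pnorm_le// ler_nat//.
(* The changes were controlled at radius k + 1; the spare unit pays for the derivative on
   [-k, k]. *)
- move=> i t tk; apply: (plim_dist (pcauchy_deriv (Pc i)) tk) => j kj.
  rewrite -derivB (le_trans (pnorm_deriv _ (ler0n _ _) (@ltr01 R)))// divr1 natr1.
  exact: dist'.
Qed.

End Target.
End Assembly.

(** * From labelled coordinates to row vectors *)

Section Coordinates.
Context {R : realType}.

Definition coord_idx {m} (i : 'I_(m + m + 1)) : idx m :=
  match fintype.split i with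
  | inl a => match fintype.split a with inl j => ix j | inr j => iy j end
  | inr _ => iz
  end.

Definition idx_coord {m} (a : idx m) : 'I_(m + m + 1) :=
  match a with
  | inl (inl j) => lshift 1 (lshift m j)
  | inl (inr j) => lshift 1 (rshift m j)
  | inr _ => rshift (m + m) ord0
  end.

Lemma coord_idxK {m} : cancel (@coord_idx m) idx_coord.
Proof.
move=> i; rewrite /coord_idx; case: (split_ordP i) => [a ->|a ->]; last by rewrite [a]ord1.
by case: (split_ordP a) => [j ->|j ->].
Qed.

Lemma idx_coordK {m} : cancel idx_coord (@coord_idx m).
Proof.
by case=> [[j|j]|[]]; rewrite /coord_idx /= ?(unsplitK (inl _)) ?(unsplitK (inr _)).
Qed.

Lemma derive1_row m (g dg : 'I_m -> R -> R) :
  (forall i (t : R), is_derive t (1 : R) (g i) (dg i t)) ->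
  (forall t : R, derivable (fun t => \row_i g i t) t 1) /\
  derive1 (fun t => \row_i g i t) = fun t => \row_i dg i t.
Proof.
move=> h; have hd t : derivable (fun t => \row_i g i t) t (1 : R).
  apply/derivable_mxP => i j.
  rewrite (_ : (fun x => _) = g j); last by apply/funext => x; rewrite mxE.
  exact: (@ex_derive _ _ _ _ _ _ _ (h j t)).
split=> //; apply/funext => t; rewrite derive1E derive_mx//.
apply/matrixP => i j; rewrite !mxE.
rewrite (_ : (fun x => _) = g j); last by apply/funext => x; rewrite mxE.
exact: (@derive_val _ _ _ _ _ _ _ (h j t)).
Qed.

(** A crude comparison: [m] is less than the square of [m.+1]. The strict form also covers
    [m = 0]. *)
Lemma euclidean_norm_lt m (v : 'rV[R]_m) (d : R) : 0 < d ->
  (forall i, `|v 0 i| < d / m.+1%:R) -> euclidean_norm v < d.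
Proof.
move=> d0 h; rewrite /euclidean_norm -[ltRHS](ger0_norm (ltW d0)) -sqrtr_sqr ltr_sqrt ?exprn_gt0//.
have m0 : 0 < m.+1%:R :> R by rewrite ltr0n.
have b0 : 0 < d / m.+1%:R by rewrite divr_gt0.
apply: (@le_lt_trans _ _ (\sum_(i < m) (d / m.+1%:R) ^+ 2)).
  apply: ler_sum => i _; rewrite -real_normK ?num_real// lerXn2r ?nnegrE ?(ltW b0)//.
  by rewrite ltW.
rewrite sumr_const card_ord -[ltLHS]mulr_natl expr_div_n mulrA ltr_pdivrMr ?exprn_gt0// mulrC.
rewrite ltr_pM2l ?exprn_gt0// -natrX ltr_nat expnS expn1.
by rewrite (leq_trans (ltnSn m))// leq_pmulr.
Qed.

End Coordinates.

Unset Implicit Arguments.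

Theorem theorem1p3 (R : realType) (n : nat) (hn : (1 < n)%N)
    (f0 : R -> 'rV[R]_(contact_dim n)) (hf0 : continuous f0)
    (eps : R -> R) (heps : continuous eps) (heps0 : forall t : R, 0 < eps t) :
  exists f : R -> 'rV[R]_(contact_dim n),
    [/\ real_analytic_curve f,
        injective f,
        immersion f,
        legendrian f
      & forall t : R, euclidean_norm (f t - f0 t) < eps t].
Proof.
(* Here [1 < n] enters: there is at least one pair (x, y) in which to oscillate. *)
have j0 : 'I_n.-1 by apply: (@Ordinal _ 0); rewrite -ltnS prednK// ltnW.
pose g0 (a : idx n.-1) t := f0 t 0 (idx_coord a).
pose e t := eps t / (contact_dim n).+1%:R.
have cg a : continuous (g0 a).
  move=> t; apply: (cvg_comp f0 (fun v : 'rV[R]_(contact_dim n) => v 0 (idx_coord a)) (hf0 t)).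
  exact: coord_continuous.
have ce : continuous e by move=> t; apply: cvgM; [exact: heps|exact: cvg_cst].
have e0 t : 0 < e t by rewrite divr_gt0.
have [P [Pc P0 Pg]] := limit_curve j0 cg ce e0.
(* The limits of the k-th derivatives are the k-th derivatives of the limit, which gives smoothness
   of all orders. *)
pose g a := plim (P a); pose dn k a := plim (fun l => (P a l)^`(k)).
have dnE k a t : is_derive t (1 : R) (dn k a) (dn k.+1 a t).
  have := is_derive_plim t (pcauchy_derivn k (Pc a)).
  have -> : (fun l => ((P a l)^`(k))^`()) = (fun l => (P a l)^`(k.+1)).
    by apply/funext => l; rewrite derivnS.
  by [].
have dn0 a : dn 0%N a = g a.
  by rewrite /dn /g; congr plim; apply/funext => l; rewrite derivn0.
have dn1 a : dn 1%N a = plim (fun l => (P a l)^`()).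
  by rewrite /dn; congr plim; apply/funext => l; rewrite derivn1.
pose f (t : R) : 'rV[R]_(contact_dim n) := \row_i g (coord_idx i) t.
pose df k (t : R) : 'rV[R]_(contact_dim n) := \row_i dn k (coord_idx i) t.
have dfE k : (forall t : R, derivable (df k) t 1) /\ derive1 (df k) = df k.+1.
  exact: (@derive1_row _ _ (fun i => dn k (coord_idx i)) (fun i => dn k.+1 (coord_idx i))).
have df0 : df 0%N = f by apply/funext => t; apply/rowP => i; rewrite !mxE dn0.
have dnf k : derive1n k f = df k.
  by elim: k => [|k ih]; [rewrite df0|rewrite derive1nS ih (proj2 (dfE k))].
have f1 : derive1 f = df 1%N by rewrite -df0 (proj2 (dfE _)).
have sm : smooth_curve f by move=> k t; rewrite dnf; exact: (proj1 (dfE k)).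
have in_seg (s t : R) : exists k : nat, `|s| <= k%:R /\ `|t| <= k%:R.
  exists (Num.trunc (`|s| + `|t|)).+1.
  by split; rewrite (le_trans _ (ltW (truncnS_gt _)))// ?lerDl ?lerDr.
exists f; split.
- by move=> i; rewrite (_ : (fun t => _) = g (coord_idx i)); [exact: plim_analytic
    |apply/funext => t; rewrite mxE].
- have sep s t : s < t -> f s <> f t.
    move=> st E; have [k [sk tk]] := in_seg s t; have [_ _ inj] := Pg k.
    have [a /eqP] := inj s t sk tk st; apply.
    by have /rowP/(_ (idx_coord a)) := E; rewrite !mxE idx_coordK.
  by move=> s t E; case: (ltgtP s t) => // st; [case: (sep s t)|case: (sep t s)].
- split=> // t u v.
  have dft : differentiable f t.
    by apply/derivable1_diffP; exact: (sm 0%N t).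
  have dfv w : 'd f t w = w *: df 1%N t.
    by rewrite -f1 (derive1E' dft) -linearZ /= [w *: 1]mulr1.
  rewrite !dfv => /eqP; rewrite -subr_eq0 -scalerBl scaler_eq0 subr_eq0 => /orP[/eqP //|/eqP d0].
  have [k [tk _]] := in_seg t t; have [_ /(_ t tk) imm _] := Pg k.
  exfalso; have z a : plim (fun l => (P a l)^`()) t = 0.
    by have /rowP/(_ (idx_coord a)) := d0; rewrite !mxE idx_coordK dn1.
  by move: imm; rewrite !z normr0 addr0 ltxx.
- split=> // t; rewrite /contact_structure /= /contact_form f1.
  have hx j : xcoord (f t) 0 j = g (ix j) t.
    by rewrite /xcoord !mxE (idx_coordK (ix j)).
  have hy j : ycoord (df 1%N t) 0 j = dn 1%N (iy j) t.
    by rewrite /ycoord !mxE (idx_coordK (iy j)).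
  have hz : zcoord (df 1%N t) = dn 1%N iz t.
    by rewrite /zcoord !mxE (idx_coordK iz).
  rewrite hz (eq_bigr (fun j => g (ix j) t * dn 1%N (iy j) t)); last by move=> j _; rewrite hx hy.
  (* The contact form along the limit is the pointwise limit of the polynomial defects, all of which
     are zero. *)
  have cv : (fun l => (pcontact (fun a => P a l)).[t]) @ \oo -->
      dn 1%N iz t + \sum_(j < n.-1) g (ix j) t * dn 1%N (iy j) t.
    under eq_fun do rewrite /pcontact hornerD horner_sum.
    apply: cvgD.
      by rewrite dn1; apply: pcauchy_cvg; exact: pcauchy_deriv.
    apply: cvg_big; first exact: add_continuous.
    move=> j _; under eq_fun do rewrite hornerM.
    by apply: cvgM; [exact: pcauchy_cvg|rewrite dn1; apply: pcauchy_cvg; exact: pcauchy_deriv].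
  rewrite -(cvg_lim _ cv)//; apply: cvg_lim => //.
  by under eq_fun do rewrite P0 horner0; exact: cvg_cst.
- move=> t; apply: euclidean_norm_lt => // i; rewrite !mxE.
  have [k [tk _]] := in_seg t t; have [/(_ (coord_idx i) t tk) + _ _] := Pg k.
  by rewrite /g0 coord_idxK.
Qed.
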